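(* Let $S$ be a positive bounded operator on $L^2(\mathbb{R}^d)$, let $\Omega\subset\mathbb{R}^{2d}$ be a measurable set with finite positive measure, and let $1\le p<\infty$. If the mixed-state localization operator $H_{\Omega,S}=\int_\Omega\alpha_z(S)\,dz$ is compact, then the mapping $f\mapsto Q_Sf$ is sequentially weak-to-norm continuous from $L^2(\mathbb{R}^d)$ to $L^p(\Omega)$; that is, $f_n\rightharpoonup f$ weakly in $L^2(\mathbb{R}^d)$ implies $\|Q_Sf_n-Q_Sf\|_{L^p(\Omega)}\to0$.
   Context: $L^2(\mathbb{R}^d)$ is a complex Hilbert space with inner product linear in the first entry. For $z=(x,\xi)\in\mathbb{R}^{2d}$, $\pi(z)f(y)=e^{2\pi i\xi\cdot y}f(y-x)$; for a bounded operator $S$ on $L^2(\mathbb{R}^d)$, $\alpha_z(S)=\pi(z)S\pi(z)^*$ and $Q_Sf(z)=\langle\alpha_z(S)f,f\rangle$. The operator $H_{\Omega,S}$ is defined as a weak integral: $\langle H_{\Omega,S}u,v\rangle=\int_\Omega\langle\alpha_z(S)u,v\rangle\,dz$ for $u,v\in L^2(\mathbb{R}^d)$. *)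

(* Defs.v *)
From HB Require Import structures.
From mathcomp Require Import all_boot all_order all_algebra.
From mathcomp Require Import all_classical all_reals all_analysis.
From mathcomp Require Import measurable_realfun complex ring lra.

Set Implicit Arguments.
Unset Strict Implicit.
Unset Printing Implicit Defensive.

Import Order.TTheory GRing.Theory Num.Theory.
Import numFieldNormedType.Exports.

Local Open Scope classical_set_scope.
Local Open Scope ring_scope.
Local Open Scope quotient_scope.
Local Open Scope complex_scope.

Local Notation Re := complex.Re.
Local Notation Im := complex.Im.
Local Notation normc := Normc.normc.

(* MathComp-Analysis has Lebesgue measure on R only. On n-tuples (with their
   product sigma-algebra) it is built by iterating the product measure. *)
Section lebesgue_measure_tuple.
Context {R : realType}.
Local Notation Rn n := (n.-tuple (measurableTypeR R)).

Definition tuple_cons n (p : measurableTypeR R * Rn n) : Rn n.+1 :=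
  [tuple of p.1 :: p.2].

Lemma measurable_tuple_cons n : measurable_fun setT (@tuple_cons n).
Proof. exact: measurable_cons. Qed.

Section step.
Variables (n : nat) (m : {sigma_finite_measure set (Rn n) -> \bar R}).
Let mcons := @measurable_tuple_cons n.

Definition lebesgue_cons : set (Rn n.+1) -> \bar R :=
  pushforward (lebesgue_measure \x m)%E (@tuple_cons n).

Let lc0 : lebesgue_cons set0 = 0%E. Proof. exact: measure0. Qed.
Let lc_ge0 A : (0 <= lebesgue_cons A)%E. Proof. exact: measure_ge0. Qed.
Let lc_sigma_additive : semi_sigma_additive lebesgue_cons.
Proof. exact: measure_semi_sigma_additive. Qed.
HB.instance Definition _ := isMeasure.Build _ _ _ lebesgue_cons
  lc0 lc_ge0 lc_sigma_additive.

Let lc_sigma_finite : sigma_finite setT lebesgue_cons.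
Proof.
have /sigma_finiteP[F [FT Fnd mF]] :=
  sigma_finiteT (lebesgue_measure : set (measurableTypeR R) -> \bar R).
have /sigma_finiteP[G [GT Gnd mG]] := sigma_finiteT m.
pose U k : set (Rn n.+1) := (fun t : Rn n.+1 => tnth t ord0) @^-1` F k `&`
  (fun t : Rn n.+1 => [tuple of behead t]) @^-1` G k.
have consU k : @tuple_cons n @^-1` U k = F k `*` G k.
  apply/seteqP; split=> -[x t]; rewrite /U /tuple_cons /= => -[Fx Gt]; split => //=;
    move: Gt; congr (G k _); exact: val_inj.
exists U.
  apply/esym; rewrite -subTset => t _.
  have [i _ Fi] : (\bigcup_i F i) (tnth t ord0) by rewrite -FT.
  have [j _ Gj] : (\bigcup_i G i) ([tuple of behead t] : Rn n) by rewrite -GT.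
  exists (maxn i j) => //; split.
  - by have /subsetPset := Fnd _ _ (leq_maxl i j); exact.
  - by have /subsetPset := Gnd _ _ (leq_maxr i j); exact.
move=> k; have [mFk Fkoo] := mF k; have [mGk Gkoo] := mG k; split.
  apply: measurableI; rewrite -[X in measurable X]setTI.
  - exact: measurable_tnth.
  - exact: measurable_behead.
rewrite /lebesgue_cons /pushforward consU product_measure1E//.
by rewrite lte_mul_pinfty// ge0_fin_numE.
Qed.
HB.instance Definition _ := Measure_isSigmaFinite.Build _ _ _ lebesgue_cons
  lc_sigma_finite.
End step.

Fixpoint lebesgue_tuple (n : nat) :
    {sigma_finite_measure set (Rn n) -> \bar R} :=
  match n with
  | 0 => (\d_ ([tuple] : Rn 0) : {sigma_finite_measure set (Rn 0) -> \bar R})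
  | n.+1 => (lebesgue_cons (lebesgue_tuple n)
      : {sigma_finite_measure set (Rn n.+1) -> \bar R})
  end.
End lebesgue_measure_tuple.

Section complex_parts.
Context {R : realType}.
Lemma normc2E (z : R[i]) : normc z ^+ 2 = Re z ^+ 2 + Im z ^+ 2.
Proof. by case: z => a b; rewrite /= sqr_sqrtr// addr_ge0 ?sqr_ge0. Qed.

Lemma ReD (z w : R[i]) : Re (z + w) = Re z + Re w.
Proof. by case: z w => [? ?] [? ?]. Qed.
Lemma ImD (z w : R[i]) : Im (z + w) = Im z + Im w.
Proof. by case: z w => [? ?] [? ?]. Qed.
Lemma ReM (z w : R[i]) : Re (z * w) = Re z * Re w - Im z * Im w.
Proof. by case: z w => [? ?] [? ?]. Qed.
Lemma ImM (z w : R[i]) : Im (z * w) = Re z * Im w + Im z * Re w.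
Proof. by case: z w => [? ?] [? ?]. Qed.
Lemma ReJ (z : R[i]) : Re z^* = Re z. Proof. by case: z. Qed.
Lemma ImJ (z : R[i]) : Im z^* = - Im z. Proof. by case: z. Qed.

End complex_parts.

Section square_integrable.
Context d {T : measurableType d} {R : realType}.
Variable mu : {measure set T -> \bar R}.
Implicit Types f g h : T -> R[i].

Definition complex_measurable (D : set T) f : Prop :=
  measurable_fun D (fun x => Re (f x)) /\ measurable_fun D (fun x => Im (f x)).

Definition complex_integral (D : set T) f : R[i] :=
  (\int[mu]_(x in D) Re (f x)) +i* (\int[mu]_(x in D) Im (f x)).

Definition square_integrable f : Prop :=
  complex_measurable setT f /\ (\int[mu]_x (normc (f x) ^+ 2)%:E < +oo)%E.

Definition L2fun : {pred T -> R[i]} := [pred f | `[< square_integrable f >]].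

Lemma L2funP f : reflect (square_integrable f) (f \in L2fun).
Proof. exact: asboolP. Qed.

Definition complex_integrable f : Prop :=
  mu.-integrable setT (EFin \o (fun x => Re (f x))) /\
  mu.-integrable setT (EFin \o (fun x => Im (f x))).

Lemma complex_measurable_cst (a : R[i]) : complex_measurable setT (cst a).
Proof. by split; exact: measurable_cst. Qed.

Lemma complex_measurableD f g : complex_measurable setT f ->
  complex_measurable setT g -> complex_measurable setT (fun x => f x + g x).
Proof.
move=> [f1 f2] [g1 g2]; split.
- by under eq_fun do rewrite ReD; exact: measurable_funD.
- by under eq_fun do rewrite ImD; exact: measurable_funD.
Qed.

Lemma complex_measurableM f g : complex_measurable setT f ->
  complex_measurable setT g -> complex_measurable setT (fun x => f x * g x).
Proof.
move=> [f1 f2] [g1 g2]; split.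
- under eq_fun do rewrite ReM.
  by apply: measurable_funB; exact: measurable_funM.
- under eq_fun do rewrite ImM.
  by apply: measurable_funD; exact: measurable_funM.
Qed.

Lemma complex_measurableJ f : complex_measurable setT f ->
  complex_measurable setT (fun x => (f x)^*).
Proof.
move=> [f1 f2]; split; first by under eq_fun do rewrite ReJ.
by under eq_fun do rewrite ImJ; exact: measurable_funN.
Qed.

Lemma measurable_normc2 f : complex_measurable setT f ->
  measurable_fun setT (fun x => (normc (f x) ^+ 2)%:E).
Proof.
move=> [f1 f2]; apply/measurable_EFinP; under eq_fun do rewrite normc2E.
by apply: measurable_funD; exact: measurable_funX.
Qed.

Lemma L2fun_submod_closed : submod_closed L2fun.
Proof.
split.
  apply/L2funP; split; first exact: complex_measurable_cst.
  by rewrite integral0_eq// => x _ /=; rewrite !(expr0n, addr0, sqrtr0).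
move=> a f g /L2funP[mf If] /L2funP[mg Ig].
have maf : complex_measurable setT (fun x => a * f x).
  by apply: complex_measurableM => //; exact: complex_measurable_cst.
have mafg : complex_measurable setT (a *: f + g).
  exact: (@complex_measurableD (fun x => a * f x)).
apply/L2funP; split => //.
pose c := 2 * normc a ^+ 2.
have c0 : 0 <= c by rewrite mulr_ge0// sqr_ge0.
have [mf2 mg2] := (measurable_normc2 mf, measurable_normc2 mg).
apply: (@le_lt_trans _ _ (\int[mu]_x
  (c%:E * (normc (f x) ^+ 2)%:E + 2%:E * (normc (g x) ^+ 2)%:E))%E).
  apply: ge0_le_integral => //.
  - by move=> x _; rewrite lee_fin sqr_ge0.
  - exact: measurable_normc2.
  - by apply: emeasurable_funD; exact: measurable_funeM.
  - move=> x _; rewrite -!EFinM -EFinD lee_fin /c -mulrA -exprMn -Normc.normcM.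
    rewrite -[leLHS]/(normc (a * f x + g x) ^+ 2) !normc2E ReD ImD.
    move: (Re (a * f x)) (Im (a * f x)) (Re (g x)) (Im (g x)) => p q r s.
    by have := sqr_ge0 (p - r); have := sqr_ge0 (q - s); nra.
rewrite ge0_integralD//=.
- rewrite !ge0_integralZl//; do ?[by move=> x _; rewrite lee_fin sqr_ge0].
  by apply: lte_add_pinfty; apply: lte_mul_pinfty.
- by move=> x _; rewrite -EFinM lee_fin mulr_ge0// sqr_ge0.
- exact: measurable_funeM.
- by move=> x _; rewrite -EFinM lee_fin mulr_ge0// sqr_ge0.
- exact: measurable_funeM.
Qed.

Lemma integrable_L2 (F : T -> R) f g : f \in L2fun -> g \in L2fun ->
  measurable_fun setT F ->
  (forall x, `|F x| <= normc (f x) ^+ 2 + normc (g x) ^+ 2) ->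
  mu.-integrable setT (EFin \o F).
Proof.
move=> /L2funP[mf If] /L2funP[mg Ig] mF FB; apply/integrableP; split.
  exact/measurable_EFinP.
have [mf2 mg2] := (measurable_normc2 mf, measurable_normc2 mg).
apply: (@le_lt_trans _ _ (\int[mu]_x
  ((normc (f x) ^+ 2)%:E + (normc (g x) ^+ 2)%:E))%E).
  apply: ge0_le_integral => //.
  - by apply: measurableT_comp => //; exact/measurable_EFinP.
  - exact: emeasurable_funD.
  - by move=> x _; rewrite -EFinD lee_fin.
rewrite ge0_integralD//=; first exact: lte_add_pinfty.
- by move=> x _; rewrite lee_fin sqr_ge0.
- by move=> x _; rewrite lee_fin sqr_ge0.
Qed.

Lemma complex_integrable_L2 f g : f \in L2fun -> g \in L2fun ->
  complex_integrable (fun x => f x * (g x)^*).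
Proof.
move=> Lf Lg; have /L2funP[mf _] := Lf; have /L2funP[mg _] := Lg.
have [m1 m2] := complex_measurableM mf (complex_measurableJ mg).
split; apply: (integrable_L2 Lf Lg) => // x.
- rewrite !normc2E ReM ReJ ImJ ler_norml.
  move: (Re (f x)) (Im (f x)) (Re (g x)) (Im (g x)) => p q r s.
  have := (sqr_ge0 (p - r), sqr_ge0 (q - s), sqr_ge0 (p + r), sqr_ge0 (q + s)).
  have := (sqr_ge0 (p - s), sqr_ge0 (q - r), sqr_ge0 (p + s), sqr_ge0 (q + r)).
  by move=> [[[? ?] ?] ?] [[[? ?] ?] ?]; apply/andP; split; nra.
- rewrite !normc2E ImM ReJ ImJ ler_norml.
  move: (Re (f x)) (Im (f x)) (Re (g x)) (Im (g x)) => p q r s.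
  have := (sqr_ge0 (p - r), sqr_ge0 (q - s), sqr_ge0 (p + r), sqr_ge0 (q + s)).
  have := (sqr_ge0 (p - s), sqr_ge0 (q - r), sqr_ge0 (p + s), sqr_ge0 (q + r)).
  by move=> [[[? ?] ?] ?] [[[? ?] ?] ?]; apply/andP; split; nra.
Qed.

Lemma complex_integralD f g : complex_integrable f -> complex_integrable g ->
  complex_integral setT (fun x => f x + g x) =
  complex_integral setT f + complex_integral setT g.
Proof.
move=> [f1 f2] [g1 g2]; rewrite /complex_integral.
under eq_Rintegral do rewrite ReD.
under [X in _ +i* X]eq_Rintegral do rewrite ImD.
by rewrite !RintegralD.
Qed.

Lemma complex_integralZ a f : complex_integrable f ->
  complex_integral setT (fun x => a * f x) = a * complex_integral setT f.
Proof.
move=> [f1 f2]; rewrite /complex_integral.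
under eq_Rintegral do rewrite ReM.
under [X in _ +i* X]eq_Rintegral do rewrite ImM.
have iZ (r : R) (h : T -> R) : mu.-integrable setT (EFin \o h) ->
  mu.-integrable setT (EFin \o (fun x => r * h x)) by exact: integrableZl.
rewrite RintegralB ?RintegralD//; try exact: iZ.
rewrite !RintegralZl//.
by case: a.
Qed.

Lemma complex_integralJ f : complex_integrable f ->
  complex_integral setT (fun x => (f x)^*) = (complex_integral setT f)^*.
Proof.
move=> [f1 f2]; rewrite /complex_integral.
under eq_Rintegral do rewrite ReJ.
under [X in _ +i* X]eq_Rintegral do rewrite ImJ -mulN1r.
by rewrite RintegralZl// mulN1r.
Qed.

End square_integrable.

Section L2space.
Context d (T : measurableType d) (R : realType).
Variable mu : {measure set T -> \bar R}.

HB.instance Definition _ := GRing.isSubmodClosed.Build R[i] (T -> R[i])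
  (L2fun mu) (L2fun_submod_closed mu).

Record L2pre := MkL2pre { L2val :> T -> R[i]; _ : L2val \in L2fun mu }.
HB.instance Definition _ := [isSub for L2val].
HB.instance Definition _ := [Choice of L2pre by <:].
HB.instance Definition _ := [SubChoice_isSubLmodule of L2pre by <:].

Definition L2null : {pred L2pre} := [pred f | `[< {ae mu, forall x, (f : L2pre) x = 0} >]].

Lemma L2valB (f g : L2pre) x : (f - g) x = f x - g x.
Proof. by rewrite [L2val _](raddfB (val : L2pre -> _)). Qed.

Lemma L2null_zmod_closed : zmod_closed L2null.
Proof.
split; first by apply/asboolP; apply: aeW.
move=> f g /asboolP f0 /asboolP g0; apply/asboolP.
by apply: filterS2 f0 g0 => x; rewrite L2valB => -> ->; rewrite subrr.
Qed.
HB.instance Definition _ := GRing.isZmodClosed.Build L2pre L2null L2null_zmod_closed.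

Definition L2 := Quotient.quot (L2null : zmodClosed L2pre).
HB.instance Definition _ := Choice.on L2.
HB.instance Definition _ := GRing.Zmodule.on L2.
HB.instance Definition _ := EqQuotient.on L2.

End L2space.

Section L2lmodule.
Context d (T : measurableType d) (R : realType).
Variable mu : {measure set T -> \bar R}.
Local Notation L2 := (L2 mu).
Local Notation L2pre := (L2pre mu).
Implicit Types (f g : L2pre) (u v w : L2) (a b : R[i]).

Lemma L2_eqP f g : reflect {ae mu, forall x, f x = g x} (\pi_L2 f == \pi_L2 g :> L2).
Proof.
rewrite -Quotient.idealrBE; apply: (iffP (asboolP _)); apply: filterS => x.
  by rewrite L2valB => /eqP; rewrite subr_eq0 => /eqP.
by rewrite L2valB => ->; rewrite subrr.
Qed.

Lemma L2valD f g x : (f + g) x = f x + g x.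
Proof. by rewrite [L2val _](raddfD (val : L2pre -> _)). Qed.

Let valZ a f : L2val (a *: f) = a *: (f : T -> R[i]).
Proof. by rewrite {1}/GRing.scale /=. Qed.

Lemma L2valZ a f x : (a *: f) x = a * f x.
Proof. by rewrite valZ. Qed.

Lemma L2repr f : {ae mu, forall x, repr (\pi_L2 f : L2) x = f x}.
Proof. by apply/L2_eqP; rewrite reprK. Qed.

Definition L2scale a u : L2 := \pi_L2 (a *: repr u).

Let pi_scale a f : L2scale a (\pi_L2 f) = \pi_L2 (a *: f).
Proof.
apply/eqP/L2_eqP; have := L2repr f; apply: filterS => x.
by rewrite !L2valZ => ->.
Qed.

Let piD f g : \pi_L2 (f + g) = \pi_L2 f + \pi_L2 g :> L2.
Proof. exact: Quotient.pi_add. Qed.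

Let pi0 : \pi_L2 0 = 0 :> L2.
Proof. by apply: (addrI (\pi_L2 0)); rewrite -piD !addr0. Qed.

Let scalerA' a b u : L2scale a (L2scale b u) = L2scale (a * b) u.
Proof.
by elim/quotW: u => f; rewrite (pi_scale b) (pi_scale a) pi_scale scalerA.
Qed.
Let scale1r' : left_id 1 L2scale.
Proof. by move=> u; elim/quotW: u => f; rewrite pi_scale scale1r. Qed.
Let scalerDr' : right_distributive L2scale +%R.
Proof.
move=> a u v; elim/quotW: u => f; elim/quotW: v => g.
by rewrite -piD !pi_scale -piD scalerDr.
Qed.
Let scalerDl' u : {morph L2scale^~ u : a b / a + b}.
Proof. by elim/quotW: u => f a b; rewrite !pi_scale -piD scalerDl. Qed.

HB.instance Definition _ := GRing.Zmodule_isLmodule.Build R[i] L2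
  scalerA' scale1r' scalerDr' scalerDl'.

Lemma pi_L2P a f g : \pi_L2 (a *: f + g) = a *: \pi_L2 f + \pi_L2 g :> L2.
Proof. by rewrite piD -pi_scale. Qed.

Definition inner u v : R[i] :=
  complex_integral mu setT (fun x => repr u x * (repr v x)^*).

Let integrable_fg f g : complex_integrable mu (fun x => f x * (g x)^*).
Proof. by apply: complex_integrable_L2; exact: valP. Qed.

Let ae_eq_complex_integral (F G : T -> R[i]) : complex_integrable mu F ->
  complex_integrable mu G -> {ae mu, forall x, F x = G x} ->
  complex_integral mu setT F = complex_integral mu setT G.
Proof.
move=> [F1 F2] [G1 G2] FG; rewrite /complex_integral /Rintegral.
congr (fine _ +i* fine _); apply: ae_eq_integral => //=;
  do ?exact: (measurable_int mu).
- by apply: filterS FG => x /= -> _.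
- by apply: filterS FG => x /= -> _.
Qed.

Lemma inner_pi f g :
  inner (\pi_L2 f) (\pi_L2 g) = complex_integral mu setT (fun x => f x * (g x)^*).
Proof.
apply: ae_eq_complex_integral => //.
by apply: filterS2 (L2repr f) (L2repr g) => x -> ->.
Qed.

Let inner_herm u v : inner u v = (inner v u)^*.
Proof.
rewrite /inner -complex_integralJ//; congr complex_integral.
by apply/funext => x; rewrite rmorphM/= conjcK mulrC.
Qed.

Let inner_linearl v a u w : inner (a *: u + w) v = a * inner u v + inner w v.
Proof.
elim/quotW: u => f; elim/quotW: w => g; elim/quotW: v => h.
rewrite -pi_L2P !inner_pi -complex_integralZ// -complex_integralD//.
  by congr complex_integral; apply/funext => x;
    rewrite L2valD L2valZ mulrDl mulrA.
rewrite (_ : (fun _ => _) = (fun x => (a *: f : L2pre) x * (h x)^*))//.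
by apply/funext => x; rewrite L2valZ mulrA.
Qed.

Let inner_bilinear : bilinear_for *%R (Num.conj \; *%R) inner.
Proof.
split=> u a v w /=; first exact: inner_linearl.
by rewrite (inner_herm u) inner_linearl (inner_herm u v) (inner_herm u w) rmorphD rmorphM.
Qed.

HB.instance Definition _ := bilinear_isBilinear.Build R[i] L2 L2 R[i]
  *%R (Num.conj \; *%R) inner inner_bilinear.

Let inner_hermitian u v : inner u v = (-1) ^+ false * Num.conj (inner v u).
Proof. by rewrite expr0 mul1r; exact: inner_herm. Qed.

HB.instance Definition _ := isHermitianSesquilinear.Build R[i] L2 false Num.conj
  inner inner_hermitian.

Let innerE f : inner (\pi_L2 f) (\pi_L2 f) =
  (fine (\int[mu]_x (normc (f x) ^+ 2)%:E)) +i* 0.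
Proof.
rewrite inner_pi /complex_integral; congr (_ +i* _).
  by apply: eq_Rintegral => x _; rewrite normc2E ReM ReJ ImJ; ring.
rewrite /Rintegral integral0_eq// => x _.
by rewrite ImM ReJ ImJ; congr (_%:E); ring.
Qed.

Let inner_gt0 u : u != 0 -> 0 < inner u u.
Proof.
elim/quotW: u => f; apply: contraNT; rewrite innerE ltcE/= eqxx/= -leNgt => If0.
have /L2funP[mf If] := valP f.
have mf2 := measurable_normc2 mf.
have I0 : (\int[mu]_x (normc (f x) ^+ 2)%:E)%E = 0%E.
  apply/eqP; rewrite eq_le integral_ge0 ?andbT; last first.
    by move=> x _; rewrite lee_fin sqr_ge0.
  rewrite -[leLHS]fineK ?lee_fin// ge0_fin_numE// integral_ge0// => x _.
  by rewrite lee_fin sqr_ge0.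
rewrite -pi0; apply/L2_eqP.
have /ae_eq_integral_abs : measurable_fun setT (fun x => (normc (f x) ^+ 2)%:E) by [].
move=> /(_ mu measurableT) [+ _].
under eq_integral do rewrite gee0_abs ?lee_fin ?sqr_ge0//.
move=> /(_ I0); apply: filterS => x /(_ Logic.I) [] /eqP.
by rewrite sqrf_eq0 => /eqP /Normc.eq0_normc.
Qed.

HB.instance Definition _ := isDotProduct.Build R[i] L2 inner inner_gt0.

End L2lmodule.

Section L2normed.
Context d (T : measurableType d) (R : realType).
Variable mu : {measure set T -> \bar R}.
Implicit Types (u v w : L2 mu) (a : R[i]).
Local Notation dot := (@inner d T R mu : {dot L2 mu for Num.conj}).
Local Notation "''[' u , v ]" := (inner u%R v%R) : ring_scope.
Local Notation "''[' u ]" := '[u, u]%R : ring_scope.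

Definition L2norm u : R[i] := sqrtC '[u].

Lemma inner_CauchySchwarz u v : `|'[u, v]| <= L2norm u * L2norm v.
Proof.
rewrite /L2norm -(sqrCK (normr_ge0 _)) -sqrtCM ?nnegrE ?(dnorm_ge0 dot)//.
rewrite ler_sqrtC ?nnegrE ?mulr_ge0 ?(dnorm_ge0 dot) ?exprn_ge0//.
have [->|v0] := eqVneq v 0; first by rewrite (linear0r dot) normr0 expr0n mulr_ge0 ?(dnorm_ge0 dot).
have v2 : 0 < '[v] by rewrite dnorm_gt0.
pose a := '[u, v] / '[v]; pose w := u - a *: v.
have wv : '[w, v] = 0.
  by rewrite linearBl/= linearZl_LR/= divfK ?subrr// gt_eqF.
have uE : u = w + a *: v by rewrite subrK.
move: w wv uE => w wv uE.
have -> : '[u, v] = '[a *: v, v] by rewrite uE (linearDl dot) /= wv add0r.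
rewrite [in leRHS]uE (@hnormDd _ _ _ _ dot)/=; last by rewrite linearZr_LR/= wv mulr0.
rewrite mulrDl dnormZ linearZl_LR/= normrM (ger0_norm (ltW v2)).
by rewrite exprMn (expr2 '[v]) mulrA lerDr mulr_ge0 ?(dnorm_ge0 dot).
Qed.

Let L2normD u v : L2norm (u + v) <= L2norm u + L2norm v.
Proof.
rewrite -ler_sqr ?nnegrE ?addr_ge0 ?sqrtC_ge0 ?(dnorm_ge0 dot)//.
rewrite sqrrD !sqrtCK addrAC (dnormD dot) lerD2l.
rewrite -[_ + _](divfK (negbT (pnatr_eq0 _ 2))) -[leRHS]mulr_natr.
rewrite ler_pM2r ?ltr0n//.
apply: le_trans (inner_CauchySchwarz u v); rewrite -ReE.
exact: (leif_Re_Creal '[u, v]).1.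
Qed.

Let L2normZ a u : L2norm (a *: u) = `|a| * L2norm u.
Proof.
by rewrite /L2norm (dnormZ dot) sqrtCM ?nnegrE ?exprn_ge0 ?(dnorm_ge0 dot)// sqrCK.
Qed.

Let L2norm0_eq0 u : L2norm u = 0 -> u = 0.
Proof. by move=> /eqP; rewrite sqrtC_eq0 (dnorm_eq0 dot) => /eqP. Qed.

HB.instance Definition _ := Lmodule_isNormed.Build R[i] (L2 mu)
  L2normD L2normZ L2norm0_eq0.

End L2normed.

Section operators.
Context d (T : measurableType d) (R : realType).
Variable mu : {measure set T -> \bar R}.
Local Notation H := (L2 mu).
Implicit Types (A : H -> H) (u v w : H).

(* The class of [f] when [f] is square integrable, and 0 otherwise. *)
Definition to_L2 (f : T -> R[i]) : H := \pi_H (insubd (0 : L2pre mu) f).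

(* The Hilbert space adjoint: [adjoint A v] is the unique [w] with
   <A u, v> = <u, w> for all [u]; it exists when [A] is linear and bounded. *)
Definition adjoint A v : H :=
  xget 0 [set w | forall u, inner (A u) v = inner u w].

Definition bounded_operator A : Prop :=
  exists M : R, forall u, `|A u| <= M%:C * `|u|.

(* In the order of [R[i]], [0 <= c] says that [c] is real and nonnegative. *)
Definition positive_operator A : Prop := forall u, 0 <= inner (A u) u.

Definition compact_operator A : Prop :=
  precompact (A @` [set u | `|u| <= 1]).

Definition weak_cvg (u_ : nat -> H) u : Prop :=
  forall v, (fun n => inner (u_ n) v : R[i]^o) @ \oo --> (inner u v : R[i]^o).

End operators.

Section Lp.
Context d (T : measurableType d) (R : realType).
Variables (mu : {measure set T -> \bar R}) (D : set T) (p : R).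
Implicit Type F : T -> R[i].

Definition Lp_norm F : \bar R :=
  'N[mu]_(p%:E) [(fun z => (normc (F z))%:E) \_ D].

Definition in_Lp F : Prop := complex_measurable D F /\ (Lp_norm F < +oo)%E.

End Lp.

Notation Rtuple R n := (n.-tuple (measurableTypeR R)).
Notation L2R R n := (L2 (@lebesgue_tuple R n)).

Section phase_space.
Variables (R : realType) (n : nat).

Definition borel_phase_measure :
    {measure set (Rtuple R n * Rtuple R n)%type -> \bar R} :=
  (lebesgue_tuple n \x lebesgue_tuple n)%E.

(* R^n x R^n with the sigma-algebra of Lebesgue (not only Borel) measurable
   sets: the Caratheodory-measurable sets of the outer measure induced by
   [borel_phase_measure]. *)
Definition phase_space : measurableType _ :=
  caratheodory_type (borel_phase_measure^*)%mu.

Definition phase_measure : {measure set phase_space -> \bar R} :=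
  completed_measure_extension (mu := borel_phase_measure).

End phase_space.

Section time_frequency.
Variables (R : realType) (n : nat).
Local Notation V := (Rtuple R n).
Local Notation H := (L2R R n).
Implicit Types (x xi y : V) (z : phase_space R n) (S : H -> H) (u v : H).

Definition tuple_sub y x : V := [tuple tnth y i - tnth x i | i < n].

Definition tuple_dot x y : R := \sum_(i < n) tnth x i * tnth y i.

Definition expi (t : R) : R[i] := cos t +i* sin t.

(* The function below is square integrable and its class does not depend on
   the representative of [u], as Lebesgue measure is translation invariant. *)
Definition tf_shift z u : H := to_L2 (lebesgue_tuple n)
  (fun y => expi (2 * pi * tuple_dot z.2 y) * repr u (tuple_sub y z.1)).

Definition alpha z S : H -> H :=
  fun u => tf_shift z (S (adjoint (tf_shift z) u)).

Definition Q S u z : R[i] := inner (alpha z S u) u.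

(* [A] is the weak integral of [alpha z S] over [Omega]. *)
Definition is_localization_operator (Omega : set (phase_space R n)) S
    (A : H -> H) : Prop :=
  forall u v, inner (A u) v =
    complex_integral (phase_measure R n) Omega (fun z => inner (alpha z S u) v).

End time_frequency.

(* Main.v *)
Require Import Defs.
From mathcomp Require Import all_boot all_order all_algebra.
From mathcomp Require Import all_classical all_reals all_analysis.
From mathcomp Require Import complex measurable_realfun ring lra.

(* Put A_z = pi(z)^* and q_z(u) = <S A_z u, A_z u> = Q_S u (z), a positive form
   with q_z(u) <= M |u|^2. For g_n = f_n - f, AM-GM on the cross term gives
   |q_z(f_n) - q_z(f)| <= (1 + 1/t) q_z(g_n) + t q_z(f) for every t > 0, and
   integrating over Omega turns the first term into <H g_n, g_n>. A weakly
   convergent sequence is bounded, so covering the image of a ball under the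
   compact operator H by finitely many small balls yields <H g_n, g_n> -> 0.
   Hence Q_S f_n -> Q_S f in L^1(Omega), and in L^p(Omega) since Q_S f_n is
   bounded uniformly in n.
   The measurability of Q_S f avoids the separability of L^2: a lambda-system
   argument shows that z |-> <F_z, G_z> is measurable when F is jointly
   measurable in (z, y) and G is only weakly measurable in z; it is applied
   with F_z = A_z f and G_z = S A_z f. *)

Set Implicit Arguments.
Unset Strict Implicit.
Unset Printing Implicit Defensive.

Import Order.TTheory GRing.Theory Num.Theory.
Import numFieldNormedType.Exports.
Local Open Scope classical_set_scope.
Local Open Scope ring_scope.
Local Open Scope quotient_scope.
Local Open Scope complex_scope.

Local Notation Re := complex.Re.
Local Notation Im := complex.Im.
Local Notation normc := Normc.normc.

(** * Integrals depending measurably on a parameter *)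

(** [S] acts on classes of functions, so a representative of S A_z f is picked for each z separately
    and nothing makes it jointly measurable in (z, y); only A_z f, which is given by a formula, is.
    Weak measurability survives, thanks to positivity: a positive operator on a complex space is
    symmetric, so <w, S A_z f> = <S w, A_z f> carries [S] on a fixed vector. The measurability lemma
    thus serves twice, first with a constant second entry, then with S A_z f. The boundedness of
    weakly convergent sequences rests on a vector built as a limit, hence the proof that L^2 is
    complete. In the final estimate the factor 1 + 1/t blows up as t tends to 0, so t is fixed
    before n tends to infinity. *)

Section parametric_integral.
Context d1 d2 (Z : measurableType d1) (Y : measurableType d2) (R : realType).
Variable mu : {measure set Y -> \bar R}.
Implicit Types (h : Z -> Y -> R) (g k : Z * Y -> R).

Let G h k :=
  measurable_fun setT (fun z => \int[mu]_y (k (z, y) * h z y)%:E)%E.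

Let meas_slice k z : measurable_fun setT k ->
  measurable_fun setT (fun y => k (z, y)).
Proof. exact: measurable_fun_pair2. Qed.

Let mprod h k z : measurable_fun setT (h z) -> measurable_fun setT k ->
  measurable_fun setT (fun y => (k (z, y) * h z y)%:E).
Proof.
move=> mh mk; apply/measurable_EFinP/measurable_funM => //.
exact: meas_slice.
Qed.

(** Dominated convergence on each slice, with dominating function [|g h|], makes the integrals
    converge pointwise in [z], and pointwise limits preserve measurability. A dominating [g] instead
    of a constant allows unbounded integrands later. *)
Let G_cvg h (k_ : nat -> Z * Y -> R) k g :
  (forall z, measurable_fun setT (h z)) ->
  (forall n, measurable_fun setT (k_ n)) ->
  (forall n p, `|k_ n p| <= g p) ->
  (forall z, mu.-integrable setT (fun y => (g (z, y) * h z y)%:E)) ->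
  (forall p, k_ n p @[n --> \oo] --> k p) ->
  (forall n, G h (k_ n)) -> G h k.
Proof.
move=> mh mk kg ig kk Gk.
apply: (emeasurable_fun_cvg (fun n z => \int[mu]_y (k_ n (z, y) * h z y)%:E)%E) => //.
move=> z _.
have [| | | | |_ _ //] := @dominated_convergence _ Y R mu setT measurableT
  (fun n y => (k_ n (z, y) * h z y)%:E) (fun y => (k (z, y) * h z y)%:E)
  (fun y => `|(g (z, y) * h z y)%:E|%E).
- by move=> ?; exact: mprod.
- apply: (emeasurable_fun_cvg (fun n y => (k_ n (z, y) * h z y)%:E)) => //.
    by move=> n; exact: mprod.
  by move=> y _; apply: cvg_EFin; [exact: nearW|apply: cvgMl; exact: kk].
- by apply: aeW => y _; apply: cvg_EFin; [exact: nearW|apply: cvgMl; exact: kk].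
- exact: integrable_abse.
- apply: aeW => y n _; rewrite lee_fin !normrM ler_wpM2r//.
  exact: le_trans (kg _ _) (ler_norm _).
Qed.

Section integrable_h.
Variable h : Z -> Y -> R.
Hypothesis ih : forall z, mu.-integrable setT (EFin \o h z).
Hypothesis mhB : forall B, measurable B ->
  measurable_fun setT (fun z => \int[mu]_(y in B) (h z y)%:E)%E.

Let mh z : measurable_fun setT (h z).
Proof. by apply/measurable_EFinP; exact: (measurable_int mu). Qed.

(** Boundedness of [k] keeps [k h] integrable, which makes this class stable under linear
    combinations and bounded pointwise limits. *)
Let G' k := [/\ measurable_fun setT k, exists M : R, forall p, `|k p| <= M & G h k].

Let bounded_integrable k z : measurable_fun setT k ->
  (exists M : R, forall p, `|k p| <= M) ->
  mu.-integrable setT (fun y => (k (z, y) * h z y)%:E).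
Proof.
move=> mk [M kM].
apply: (@le_integrable _ _ _ mu _ measurableT _ (fun y => (M * h z y)%:E)).
- exact: mprod.
- move=> y _ /=; rewrite lee_fin !normrM ler_wpM2r//.
  exact: le_trans (kM _) (ler_norm _).
- exact: (integrableZl measurableT M (ih z)).
Qed.

Let G'D k g a : G' k -> G' g -> G' (fun p => k p + a * g p).
Proof.
move=> [mk bk Gk] [mg bg Gg]; have mag := measurable_funM (measurable_cst a) mg.
split.
- by apply: measurable_funD.
- have [M kM] := bk; have [N gN] := bg; exists (M + `|a| * N) => p.
  by rewrite (le_trans (ler_normD _ _))// lerD// normrM ler_wpM2l.
- rewrite /G (_ : (fun _ => _) = (fun z => \int[mu]_y (k (z, y) * h z y)%:E +
     a%:E * \int[mu]_y (g (z, y) * h z y)%:E)%E).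
    by apply: emeasurable_funD => //; exact: measurable_funeM.
  apply/funext => z.
  rewrite -integralZl//; last exact: bounded_integrable.
  rewrite -integralD//.
  + by apply: eq_integral => y _ /=; rewrite -EFinM -EFinD; congr (_%:E); ring.
  + exact: bounded_integrable.
  + exact: (integrableZl measurableT a (bounded_integrable z mg bg)).
Qed.

Let G'_cvg (k_ : nat -> Z * Y -> R) k :
  (exists M : R, forall n p, `|k_ n p| <= M) -> (forall p, k_ n p @[n --> \oo] --> k p) ->
  measurable_fun setT k ->
  (forall n, G' (k_ n)) -> G' k.
Proof.
move=> [M kM] kk mk Gk; split => //.
- exists M => p.
  have kkn : `|k_ n p| @[n --> \oo] --> `|k p| by exact: cvg_norm.
  rewrite -(cvg_lim (@Rhausdorff R) kkn); apply: limr_le.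
    by apply/cvg_ex; eexists; exact: kkn.
  by apply: nearW => n; exact: kM.
- apply: (@G_cvg h k_ k (cst M)) => //.
  + by move=> n; case: (Gk n).
  + by move=> z; apply: bounded_integrable => //; exists `|M|.
  + by move=> n; case: (Gk n).
Qed.

Let G'_indic E : measurable E -> G' (\1_E : Z * Y -> R).
Proof.
pose B := [set E | measurable E /\ G' (\1_E : Z * Y -> R)].
move: E; suff : measurable `<=` B.
  by move=> + E mE => /(_ E mE)[].
rewrite measurable_prod_measurableType.
set C := [set A1 `*` A2 | A1 in measurable & A2 in measurable].
have CI : setI_closed C.
  move=> X X' [X1 mX1 [X2 mX2 <-{X}]] [Y1 mY1 [Y2 mY2 <-{X'}]].
  exists (X1 `&` Y1); first exact: measurableI.
  by exists (X2 `&` Y2); [exact: measurableI|rewrite setXI].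
have CT : C setT by exists setT => //; exists setT => //; rewrite setXTT.
have indic1 (E : set (Z * Y)) p : `|\1_E p : R| <= 1.
  by rewrite indicE; case: (_ \in _); rewrite ?normr1// normr0.
have CB : C `<=` B.
  move=> X [X1 mX1 [X2 mX2 <-{X}]].
  have mX : measurable (X1 `*` X2) by exact: measurableX.
  split => //; split.
  - exact: measurable_indic.
  - by exists 1.
  (* On a rectangle the parameter factors out, and what remains is the integral over [X2] covered by
     [mhB]. *)
  - rewrite /G (_ : (fun _ => _) =
        (fun z => (\1_X1 z)%:E * \int[mu]_(y in X2) (h z y)%:E)%E).
      apply: emeasurable_funM; last exact: mhB.
      by apply/measurable_EFinP; exact: measurable_indic.
    apply/funext => z; rewrite -integralZl//; last exact: integrableS (ih z).
    rewrite [RHS]integral_mkcond; apply: eq_integral => y _.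
    rewrite patchE -EFinM !indicE in_setX /=.
    by case: (z \in X1); case: (y \in X2); rewrite /= ?(mul1r, mul0r).
suff lsystemB : lambda_system setT B by exact: lambda_system_subset.
split => //; first exact: CB.
- move=> X X' XX' [mX GX] [mX' GX']; split; first exact: measurableD.
  rewrite (_ : \1_(X `\` X') = (fun p => \1_X p + (-1) * \1_X' p : R)); first exact: G'D.
  apply/funext => p; rewrite !indicE in_setD.
  have [pX'|] := boolP (p \in X'); last by rewrite andbT mulr0 addr0.
  have -> : p \in X by apply/mem_set/XX'/set_mem.
  by rewrite /= mulr1 subrr.
- move=> F ndF FB.
  have mF : measurable (\bigcup_i F i) by apply: bigcup_measurable => i _; case: (FB i).
  split => //; apply: (@G'_cvg (fun n => \1_(F n))).
  + by exists 1 => n p; exact: indic1.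
  + move=> p; rewrite indicE; have [/set_mem[i _ Fip]|] := boolP (_ \in _).
      apply: cvg_near_cst; near=> n; rewrite indicE mem_set//.
      have /subsetPset Fin : (F i <= F n)%O.
        by apply: ndF; near: n; exact: nbhs_infty_ge.
      exact: Fin.
    move=> npF; apply: cvg_near_cst; apply: nearW => n; rewrite indicE.
    by rewrite memNset// => Fnp; move/negP: npF; apply; apply/mem_set; exists n.
  + exact: measurable_indic.
  + by move=> n; case: (FB n).
Unshelve. all: by end_near.
Qed.

Import HBNNSimple.

Let G'_nnsfun (f : {nnsfun (Z * Y) >-> R}) : G' f.
Proof.
have Gs (s : seq R) : G' (fun p => \sum_(r <- s) r * \1_(f @^-1` [set r]) p).
  elim: s => [|r s ihs].
    split; last 1 first.
    - rewrite /G; under eq_fun do (under eq_integral do rewrite big_nil mul0r).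
      under eq_fun do rewrite integral0.
      exact: measurable_cst.
    - by under eq_fun do rewrite big_nil; exact: measurable_cst.
    - by exists 0 => p; rewrite big_nil normr0.
  rewrite (_ : (fun _ => _) = (fun p => (\sum_(r <- s) r * \1_(f @^-1` [set r]) p) +
     r * \1_(f @^-1` [set r]) p)); last first.
    by apply/funext => p; rewrite big_cons addrC.
  by apply: G'D => //; exact: G'_indic.
have := Gs (finmap.enum_fset (fset_set (range f))); congr G'; apply/funext => p.
by rewrite [RHS]fimfunE fsbig_finite.
Qed.

(** Simple functions increase to [g], so [g] itself dominates them and no bound on [g] is
    required. *)
Lemma measurable_param_ge0 g : measurable_fun setT g -> (forall p, 0 <= g p) ->
  (forall z, mu.-integrable setT (fun y => (g (z, y) * h z y)%:E)) -> G h g.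
Proof.
move=> mg g0 ig.
have mg' : measurable_fun setT (EFin \o g) by exact/measurable_EFinP.
pose g_ := nnsfun_approx measurableT mg'.
have cg p : EFin \o g_ ^~ p @ \oo --> (g p)%:E.
  by apply: (@cvg_nnsfun_approx _ _ _ _ measurableT _ mg') => //= q _; rewrite lee_fin.
apply: (@G_cvg h g_ g g) => //.
- move=> n p; rewrite ger0_norm//.
  rewrite -lee_fin /g_ nnsfun_approxE.
  by apply: (@le_approx _ _ _ setT (EFin \o g)) => // q _; rewrite lee_fin.
- by move=> p; exact: (fine_cvg (cg p)).
- by move=> n; case: (G'_nnsfun (g_ n)).
Qed.

End integrable_h.

Let measurable_param_sfinite_ge0 h g : sigma_finite setT mu ->
  measurable_fun setT g -> (forall p, 0 <= g p) ->
  (forall z, measurable_fun setT (h z)) ->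
  (forall z B, measurable B -> (mu B < +oo)%E ->
    mu.-integrable B (EFin \o h z)) ->
  (forall B, measurable B -> (mu B < +oo)%E ->
    measurable_fun setT (fun z => \int[mu]_(y in B) (h z y)%:E)%E) ->
  (forall z, mu.-integrable setT (fun y => (g (z, y) * h z y)%:E)) -> G h g.
Proof.
move=> /sigma_finiteP[F [FT ndF mF]] mg g0 mh ih mhB ig.
have mFn n : measurable (setT `*` F n : set (Z * Y)).
  by apply: measurableX => //; exact: (mF n).1.
have cutE (k : Y -> R) n y : (k \_ (F n)) y = \1_(F n) y * k y.
  by rewrite patchE indicE; case: ifPn; rewrite ?mul1r ?mul0r.
have cut_int (k : Y -> R) B n : measurable B ->
    (\int[mu]_(y in B) ((k \_ (F n)) y)%:E = \int[mu]_(y in B `&` F n) (k y)%:E)%E.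
  by move=> mB; rewrite integral_mkcondr; apply: eq_integral => y _; rewrite restrict_EFin.
apply: (@G_cvg h (fun n p => \1_(F n) p.2 * g p) g g) => //.
- move=> n; apply: measurable_funM => //.
  by apply: (measurableT_comp _ measurable_snd); apply: measurable_indic; exact: (mF n).1.
- move=> n p; rewrite normrM indicE (ger0_norm (g0 p)) ler_piMl//.
  by case: (_ \in _); rewrite ?normr1 ?normr0.
- move=> p; have [n _ Fnp] : (\bigcup_i F i) p.2 by rewrite -FT.
  apply: cvg_near_cst; near=> m.
  have /subsetPset Fm : (F n <= F m)%O by apply: ndF; near: m; exact: nbhs_infty_ge.
  by rewrite indicE mem_set ?mul1r//; exact: Fm.
(* The cut-off to [F n] is moved from [g] to [h z]: the truncated [h z] is integrable on the whole
   space, as the previous lemma demands. *)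
- move=> n; have [mn nfin] := mF n.
  rewrite /G (_ : (fun _ => _) =
    (fun z => \int[mu]_y (g (z, y) * (h z \_ (F n)) y)%:E)%E); last first.
    apply/funext => z; apply: eq_integral => y _; rewrite cutE /=; congr (_%:E).
    by ring.
  apply: measurable_param_ge0 => //.
  + move=> z; have := integrable_mkcond (EFin \o h z) mn => /(_ mu) [/(_ (ih z _ mn nfin)) + _].
    by rewrite restrict_EFin.
  + move=> B mB; rewrite (_ : (fun _ => _) =
      (fun z => \int[mu]_(y in B `&` F n) (h z y)%:E)%E).
      apply: mhB; first exact: measurableI.
      apply: le_lt_trans nfin; apply: le_measure; rewrite ?inE//.
      exact: measurableI.
    by apply/funext => z; rewrite cut_int.
  + move=> z; apply: (@le_integrable _ _ _ mu _ measurableT _ _ _ _ (ig z)).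
      apply: (@mprod (fun z => h z \_ (F n))) => //.
      have -> : h z \_ (F n) = (fun y => \1_(F n) y * h z y).
        by apply/funext => y; rewrite cutE.
      by apply: measurable_funM => //; exact: measurable_indic.
    move=> y _ /=; rewrite lee_fin cutE !normrM ler_wpM2l// ler_piMl//.
    by rewrite indicE; case: (_ \in _); rewrite ?normr1 ?normr0.
Unshelve. all: by end_near.
Qed.

(* [h z] need not be jointly measurable: the sets [E] for which the slices
   [\1_E (z, _)] integrate measurably against [h z] form a lambda-system. *)
Lemma measurable_fun_param_integral h g : sigma_finite setT mu ->
  measurable_fun setT g ->
  (forall z, measurable_fun setT (h z)) ->
  (forall z B, measurable B -> (mu B < +oo)%E ->
    mu.-integrable B (EFin \o h z)) ->
  (forall B, measurable B -> (mu B < +oo)%E ->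
    measurable_fun setT (fun z => \int[mu]_(y in B) (h z y)%:E)%E) ->
  (forall z, mu.-integrable setT (fun y => (g (z, y) * h z y)%:E)) ->
  measurable_fun setT (fun z => \int[mu]_y (g (z, y) * h z y)%:E)%E.
Proof.
move=> sf mg mh ih mhB ig.
have igp z : mu.-integrable setT (fun y => (Num.max (g (z, y)) 0 * h z y)%:E).
  apply: (@le_integrable _ _ _ mu _ measurableT _ _ _ _ (ig z)).
    by apply: (@mprod h (fun p => Num.max (g p) 0)) => //; exact: measurable_funrpos.
  move=> y _ /=; rewrite lee_fin !normrM ler_wpM2r//.
  by case: (leP (g (z, y)) 0); rewrite ?normr0.
have ign z : mu.-integrable setT (fun y => (Num.max (- g (z, y)) 0 * h z y)%:E).
  apply: (@le_integrable _ _ _ mu _ measurableT _ _ _ _ (ig z)).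
    by apply: (@mprod h (fun p => Num.max (- g p) 0)) => //; exact: measurable_funrneg.
  move=> y _ /=; rewrite lee_fin !normrM ler_wpM2r//.
  by case: (leP (- g (z, y)) 0); rewrite ?normr0 ?normrN.
rewrite (_ : (fun _ => _) = (fun z => \int[mu]_y (Num.max (g (z, y)) 0 * h z y)%:E -
    \int[mu]_y (Num.max (- g (z, y)) 0 * h z y)%:E)%E); last first.
  apply/funext => z; rewrite -integralB//; apply: eq_integral => y _ /=.
  rewrite -EFinB -mulrBl; congr ((_ * _)%:E).
  by case: (leP (g (z, y)) 0) => g0; case: (leP (- g (z, y)) 0) => g1; lra.
apply: emeasurable_funB.
- apply: (@measurable_param_sfinite_ge0 h (fun p => Num.max (g p) 0)) => //.
  + exact: measurable_funrpos.
  + by move=> p; rewrite le_max lexx orbT.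
- apply: (@measurable_param_sfinite_ge0 h (fun p => Num.max (- g p) 0)) => //.
  + exact: measurable_funrneg.
  + by move=> p; rewrite le_max lexx orbT.
Qed.

End parametric_integral.

(** * Translation invariance of Lebesgue measure on R^n *)

Section translation.
Context {R : realType}.
Local Notation Rn n := (Rtuple R n).
Local Notation leb := (lebesgue_measure : {measure set (measurableTypeR R) -> \bar R}).

(** Lebesgue measure is determined by its values on half-open intervals, where the pushforward is
    computed directly. *)
Lemma lebesgue_measure_translation (a : R) (A : set R) : measurable A ->
  pushforward leb ((fun t => t - a) : measurableTypeR R -> measurableTypeR R) A = leb A.
Proof.
move=> mA; apply/esym/lebesgue_measure_unique => //=.
  by apply: measurable_funB => //; exact: measurable_cst.
move=> _ _ [[b c]] _ <-; rewrite /pushforward.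
rewrite (_ : _ @^-1` _ = `]b + a, c + a]%classic); last first.
  by apply/seteqP; split=> t; rewrite /= !in_itv /= ltrBrDr lerBlDr.
rewrite !lebesgue_measure_itv/= !lte_fin ltrD2r; case: ifP => // _.
by rewrite -!EFinB; congr (_%:E); ring.
Qed.

Lemma ge0_integral_lebesgue_translation (a : R) (f : R -> \bar R) :
  measurable_fun setT f -> (forall t, 0 <= f t)%E ->
  (\int[leb]_t f (t - a)%R = \int[leb]_t f t)%E.
Proof.
move=> mf f0; have ma : measurable_fun setT
    ((fun t => t - a) : measurableTypeR R -> measurableTypeR R).
  by apply: measurable_funB => //; exact: measurable_cst.
transitivity (\int[pushforward leb
  ((fun t => t - a)%R : measurableTypeR R -> measurableTypeR R)]_t f t)%E.
  by rewrite ge0_integral_pushforward.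
by apply: eq_measure_integral => // A mA _; exact: lebesgue_measure_translation.
Qed.

Lemma measurable_tuple_sub n :
  measurable_fun setT (fun p : Rn n * Rn n => tuple_sub p.1 p.2).
Proof.
apply/measurable_fun_tnthP => i.
rewrite (_ : _ \o _ = (fun p : Rn n * Rn n => tnth p.1 i - tnth p.2 i)); last first.
  by apply/funext => p; rewrite /= tnth_mktuple.
apply: measurable_funB.
- by apply: (measurableT_comp (measurable_tnth i)); exact: measurable_fst.
- by apply: (measurableT_comp (measurable_tnth i)); exact: measurable_snd.
Qed.

Lemma measurable_tuple_subl n (x : Rn n) :
  measurable_fun setT (fun y => tuple_sub y x).
Proof.
exact: (measurable_fun_pair1 x (@measurable_tuple_sub n)).
Qed.

Lemma tuple_sub_cons n (t : R) (y : Rn n) (x : Rn n.+1) :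
  tuple_sub (tuple_cons (t, y)) x =
  tuple_cons (t - thead x, tuple_sub y (behead_tuple x)).
Proof.
apply: eq_from_tnth => i; rewrite tnth_mktuple.
case: (unliftP ord0 i) => [j|] ->; rewrite ?tnthS ?tnth0 ?tnth_mktuple //.
by rewrite tnth_behead; congr (_ - tnth _ _); apply: val_inj; rewrite /= inordK// ltnS.
Qed.

(** Induction on [n]: the measure of [A] is the integral of the measures of its sections. The
    induction hypothesis translates each section, and the one-dimensional case translates the outer
    variable. For [n = 0] the space is a point. *)
Lemma lebesgue_tuple_translation n (x : Rn n) (A : set (Rn n)) : measurable A ->
  lebesgue_tuple n ((fun y => tuple_sub y x) @^-1` A) = lebesgue_tuple n A.
Proof.
elim: n x A => [|n ih] x A mA.
  rewrite (_ : _ @^-1` _ = A)//; apply/seteqP.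
  by split=> y; rewrite /= (tuple0 y) (tuple0 (tuple_sub _ _)).
set B := @tuple_cons R n @^-1` A.
have mB : measurable B.
  by rewrite -[B]setTI; exact: (@measurable_tuple_cons R n).
transitivity (\int[leb]_t (lebesgue_tuple n (xsection B (t - thead x)%R)))%E.
  rewrite /= /lebesgue_cons /pushforward /product_measure1.
  apply: eq_integral => t _ /=.
  rewrite -(ih (behead_tuple x) (xsection B (t - thead x))); last exact: measurable_xsection.
  congr (lebesgue_tuple n _); apply/seteqP; split=> y;
    by rewrite /xsection /= !inE /B /= tuple_sub_cons.
rewrite (ge0_integral_lebesgue_translation (thead x)
  (f := fun t => lebesgue_tuple n (xsection B t))) //.
exact: measurable_fun_xsection.
Qed.

Lemma ge0_integral_tuple_translation n (x : Rn n) (f : Rn n -> \bar R) :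
  measurable_fun setT f -> (forall t, 0 <= f t)%E ->
  (\int[lebesgue_tuple n]_y f (tuple_sub y x) = \int[lebesgue_tuple n]_y f y)%E.
Proof.
move=> mf f0; have mx := measurable_tuple_subl x.
transitivity (\int[pushforward (lebesgue_tuple n) (fun y : Rn n => tuple_sub y x)]_t f t)%E.
  by rewrite ge0_integral_pushforward.
by apply: eq_measure_integral => // A mA _; exact: lebesgue_tuple_translation.
Qed.

Lemma integral_tuple_translation n (x : Rn n) (f : Rn n -> \bar R) :
  measurable_fun setT f ->
  (\int[lebesgue_tuple n]_y f (tuple_sub y x) = \int[lebesgue_tuple n]_y f y)%E.
Proof.
move=> mf; rewrite [LHS]integralE [RHS]integralE; congr (_ - _)%E.
- have := ge0_integral_tuple_translation x (measurable_funepos mf) (fun y => funepos_ge0 f y).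
  by move=> <-; apply: eq_integral => y _; rewrite !funeposE.
- have := ge0_integral_tuple_translation x (measurable_funeneg mf) (fun y => funeneg_ge0 f y).
  by move=> <-; apply: eq_integral => y _; rewrite !funenegE.
Qed.

End translation.

(** * The Hilbert space L^2 *)

Section L2_facts.
Context d (T : measurableType d) (R : realType).
Variable mu : {measure set T -> \bar R}.
Implicit Types (u v w : L2 mu) (f g : T -> R[i]).
Local Notation dot := (@inner d T R mu : {dot L2 mu for Num.conj}).

Lemma complex_measurableB (D : set T) f g : complex_measurable D f ->
  complex_measurable D g -> complex_measurable D (fun x => f x - g x).
Proof.
move=> [f1 f2] [g1 g2]; split.
- rewrite (_ : (fun _ => _) = (fun x => Re (f x) - Re (g x))).
    exact: measurable_funB.
  by apply/funext => x; case: (f x) => a b; case: (g x).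
- rewrite (_ : (fun _ => _) = (fun x => Im (f x) - Im (g x))).
    exact: measurable_funB.
  by apply/funext => x; case: (f x) => a b; case: (g x).
Qed.

Lemma Re_complex_integral D f :
  Re (complex_integral mu D f) = \int[mu]_(x in D) Re (f x).
Proof. by []. Qed.

Lemma Im_complex_integral D f :
  Im (complex_integral mu D f) = \int[mu]_(x in D) Im (f x).
Proof. by []. Qed.

Lemma to_L2_repr u : to_L2 mu (repr u) = u.
Proof.
rewrite /to_L2 -[RHS]reprK; congr (\pi_(L2 mu) _).
by apply: val_inj; rewrite /= insubdK//; exact: valP.
Qed.

Lemma inner_to_L2 f g : f \in L2fun mu -> g \in L2fun mu ->
  inner (to_L2 mu f) (to_L2 mu g) =
  complex_integral mu setT (fun x => f x * (g x)^*).
Proof. by move=> Lf Lg; rewrite /to_L2 inner_pi !insubdK. Qed.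

Lemma inner_to_L2l f v : f \in L2fun mu ->
  inner (to_L2 mu f) v = complex_integral mu setT (fun x => f x * (repr v x)^*).
Proof.
by move=> Lf; rewrite -[in LHS](to_L2_repr v) inner_to_L2//; exact: valP.
Qed.

Lemma inner_to_L2r u g : g \in L2fun mu ->
  inner u (to_L2 mu g) = complex_integral mu setT (fun x => repr u x * (g x)^*).
Proof.
by move=> Lg; rewrite -[in LHS](to_L2_repr u) inner_to_L2//; exact: valP.
Qed.

Lemma inner_conj u v : inner u v = (inner v u)^*%R.
Proof. by have := hermC dot u v; rewrite /= expr0 mul1r. Qed.

Lemma inner_inj u v : (forall w, inner w u = inner w v) -> u = v.
Proof.
move=> uv; apply/eqP; rewrite -subr_eq0 -(dnorm_eq0 dot) /=.
by rewrite (linearBr dot) /= uv subrr.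
Qed.

Lemma L2fun_indic (B : set T) : measurable B -> (mu B < +oo)%E ->
  (fun x => (\1_B x)%:C) \in L2fun mu.
Proof.
move=> mB Boo; apply/L2funP; split.
  by split; [exact: measurable_indic|exact: measurable_cst].
rewrite (_ : (fun _ => _) = (fun x => (\1_B x)%:E)); last first.
  by apply/funext => x; rewrite normc2E /= indicE; case: (_ \in _);
    congr (_%:E); rewrite /=; ring.
by rewrite integral_indic// setIT.
Qed.

End L2_facts.

Section normc_parts.
Context {R : realType}.
Implicit Types z : R[i].

Lemma normc_ge0 z : 0 <= normc z. Proof. by case: z => a b; exact: sqrtr_ge0. Qed.

Lemma le_Re_normc z : `|Re z| <= normc z.
Proof. by case: z => a b /=; rewrite -sqrtr_sqr ler_wsqrtr// lerDl sqr_ge0. Qed.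

Lemma le_Im_normc z : `|Im z| <= normc z.
Proof. by case: z => a b /=; rewrite -sqrtr_sqr ler_wsqrtr// lerDr sqr_ge0. Qed.

Lemma normc_real (a : R) : normc a%:C = `|a|.
Proof. by rewrite /= expr0n /= addr0 sqrtr_sqr. Qed.

End normc_parts.

(** * Inner products of a jointly measurable and a weakly measurable family *)

Section measurable_inner.
Context d1 d2 (Z : measurableType d1) (T : measurableType d2) (R : realType).
Variable mu : {sigma_finite_measure set T -> \bar R}.

(** Here [g] stands for the real or imaginary part of [G], and [h] for that of [psi]; the four
    combinations make up the complex inner product. *)
Let measurable_parts (h : Z -> T -> R) (g : Z * T -> R) (G : Z -> T -> R[i])
    (psi : Z -> T -> R[i]) :
  (forall z, G z \in L2fun mu) -> (forall z, psi z \in L2fun mu) ->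
  measurable_fun setT g -> (forall z, measurable_fun setT (h z)) ->
  (forall z x, `|g (z, x)| <= normc (G z x)) ->
  (forall z x, `|h z x| <= normc (psi z x)) ->
  (forall B, measurable B -> (mu B < +oo)%E ->
    measurable_fun setT (fun z => \int[mu]_(x in B) (h z x)%:E)%E) ->
  (forall z, mu.-integrable setT (fun x => (g (z, x) * h z x)%:E)) /\
  measurable_fun setT (fun z => \int[mu]_x (g (z, x) * h z x)).
Proof.
move=> LG Lp mg mh gG hp mhB.
have bound (a b p q : R) : `|a| <= p -> `|b| <= q -> `|a * b| <= p ^+ 2 + q ^+ 2.
  move=> ap bq; rewrite normrM.
  have := (normr_ge0 a, normr_ge0 b); move: `|a| `|b| ap bq => a' b' ap bq [a0 b0].
  have := (sqr_ge0 (p - q), sqr_ge0 p, sqr_ge0 q).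
  by move=> [[? ?] ?]; have := ler_pM a0 b0 ap bq; nra.
have igh z : mu.-integrable setT (fun x => (g (z, x) * h z x)%:E).
  apply: (integrable_L2 (LG z) (Lp z)) => [|x]; last exact: bound.
  by apply: measurable_funM => //; exact: measurable_fun_pair2.
split => //; apply: measurableT_comp => //.
apply: measurable_fun_param_integral => //.
- exact: sigma_finiteT.
- move=> z B mB Boo.
  have := integrable_mkcond (EFin \o h z) mB => /(_ mu) [_]; apply.
  rewrite restrict_EFin.
  apply: (integrable_L2 (L2fun_indic mB Boo) (Lp z)).
    have -> : h z \_ B = (fun x => \1_B x * h z x).
      by apply/funext => y; rewrite patchE indicE; case: ifPn; rewrite ?mul1r ?mul0r.
    by apply: measurable_funM => //; exact: measurable_indic.
  move=> x; rewrite patchE indicE; case: ifPn => _; last first.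
    by rewrite normr0 addr_ge0 ?sqr_ge0.
  rewrite -[h z x]mul1r; apply: bound => //.
  by rewrite normc_real.
Qed.

Lemma measurable_inner (G : Z -> T -> R[i]) (psi : Z -> L2 mu) :
  measurable_fun setT (fun p : Z * T => Re (G p.1 p.2)) ->
  measurable_fun setT (fun p : Z * T => Im (G p.1 p.2)) ->
  (forall z, G z \in L2fun mu) ->
  (forall w, complex_measurable setT (fun z => inner w (psi z))) ->
  complex_measurable setT (fun z => inner (to_L2 mu (G z)) (psi z)).
Proof.
move=> mG1 mG2 LG mpsi.
pose P z : T -> R[i] := repr (psi z).
have LP z : P z \in L2fun mu by exact: valP.
have mP z : complex_measurable setT (P z) by have /L2funP[] := LP z.
have indic_int (B : set T) (r : T -> R) : measurable B ->
    (\int[mu]_(x in B) (r x)%:E = \int[mu]_x (\1_B x * r x)%:E)%E.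
  move=> mB; rewrite integral_mkcond; apply: eq_integral => x _.
  by rewrite patchE indicE; case: ifPn; rewrite ?mul1r ?mul0r.
(* Weak measurability tested on the indicator of [B] gives the integrals of [psi z] over [B]. Finite
   measure of [B] is what puts the indicator in L^2. *)
have mBRe (B : set T) : measurable B -> (mu B < +oo)%E ->
    measurable_fun setT (fun z => \int[mu]_(x in B) (Re (P z x))%:E)%E.
  move=> mB Boo; have LB := L2fun_indic mB Boo.
  have [+ _] := mpsi (to_L2 mu (fun x => (\1_B x)%:C)).
  move=> /measurable_EFinP; congr (measurable_fun _ _); apply/funext => z.
  rewrite [LHS]/comp inner_to_L2l// Re_complex_integral indic_int// /Rintegral fineK.
    by apply: eq_integral => x _; congr (_%:E); rewrite Defs.ReM Defs.ReJ Defs.ImJ /=; ring.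
  by apply: integrable_fin_num => //; have [] := complex_integrable_L2 LB (LP z).
have mBIm (B : set T) : measurable B -> (mu B < +oo)%E ->
    measurable_fun setT (fun z => \int[mu]_(x in B) (Im (P z x))%:E)%E.
  move=> mB Boo; have LB := L2fun_indic mB Boo.
  have [_ +] := mpsi (to_L2 mu (fun x => (\1_B x)%:C)).
  (* The second entry of the inner product is conjugated, hence the change of sign. *)
  move=> /measurable_funN /measurable_EFinP.
  congr (measurable_fun _ _); apply/funext => z.
  have [_ iIm] := complex_integrable_L2 LB (LP z).
  transitivity ((- Im (inner (to_L2 mu (fun x => (\1_B x)%:C)) (psi z)))%:E) => //.
  rewrite inner_to_L2l// Im_complex_integral indic_int// /Rintegral EFinN fineK;
    last exact: integrable_fin_num.
  rewrite -integralN//=; last exact: integrable_add_def.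
  by apply: eq_integral => x _; congr (_%:E); rewrite Defs.ImM Defs.ReJ Defs.ImJ /=; ring.
have Gb1 z x : `|Re (G z x)| <= normc (G z x) by exact: le_Re_normc.
have Gb2 z x : `|Im (G z x)| <= normc (G z x) by exact: le_Im_normc.
have Pb1 z x : `|Re (P z x)| <= normc (P z x) by exact: le_Re_normc.
have Pb2 z x : `|Im (P z x)| <= normc (P z x) by exact: le_Im_normc.
have mP1 z : measurable_fun setT (fun x => Re (P z x)) by case: (mP z).
have mP2 z : measurable_fun setT (fun x => Im (P z x)) by case: (mP z).
have [i11 m11] := measurable_parts LG LP mG1 mP1 Gb1 Pb1 mBRe.
have [i12 m12] := measurable_parts LG LP mG1 mP2 Gb1 Pb2 mBIm.
have [i21 m21] := measurable_parts LG LP mG2 mP1 Gb2 Pb1 mBRe.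
have [i22 m22] := measurable_parts LG LP mG2 mP2 Gb2 Pb2 mBIm.
under eq_fun do rewrite inner_to_L2l//.
split.
- move: (measurable_funD m11 m22); congr (measurable_fun _ _); apply/funext => z /=.
  rewrite -RintegralD//; [|exact: i11|exact: i22].
  by apply: eq_Rintegral => x _; rewrite Defs.ReM Defs.ReJ Defs.ImJ /=; ring.
- move: (measurable_funB m21 m12); congr (measurable_fun _ _); apply/funext => z /=.
  rewrite -RintegralB//; [|exact: i21|exact: i12].
  by apply: eq_Rintegral => x _; rewrite Defs.ImM Defs.ReJ Defs.ImJ /=; ring.
Qed.

End measurable_inner.

(** * Time-frequency shifts *)

Section complex_translation.
Context {R : realType} {n : nat}.
Local Notation V := (Rtuple R n).
Local Notation mu := (@lebesgue_tuple R n).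
Implicit Types (x xi y : V) (f g : V -> R[i]).

Definition tuple_opp x : V := [tuple - tnth x i | i < n].

Lemma tuple_subNK y x : tuple_sub (tuple_sub y (tuple_opp x)) x = y.
Proof. by apply: eq_from_tnth => i; rewrite !tnth_mktuple opprK addrK. Qed.

Lemma complex_measurable_comp d (X : measurableType d) (phi : X -> V) f :
  measurable_fun setT phi -> complex_measurable setT f ->
  complex_measurable setT (f \o phi).
Proof.
by move=> mphi [mf1 mf2]; split;
  [exact: (measurableT_comp mf1 mphi)|exact: (measurableT_comp mf2 mphi)].
Qed.

Lemma complex_integral_translation x f : complex_measurable setT f ->
  complex_integral mu setT (fun y => f (tuple_sub y x)) = complex_integral mu setT f.
Proof.
move=> [mf1 mf2]; rewrite /complex_integral /Rintegral.
rewrite (integral_tuple_translation x (f := fun y => (Re (f y))%:E)); last exact/measurable_EFinP.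
by rewrite (integral_tuple_translation x (f := fun y => (Im (f y))%:E));
  last exact/measurable_EFinP.
Qed.

Lemma measurable_tuple_dot :
  measurable_fun setT (fun p : V * V => tuple_dot p.1 p.2).
Proof.
rewrite /tuple_dot; apply: measurable_sum => i; apply: measurable_funM.
- by apply: (measurableT_comp (measurable_tnth i)); exact: measurable_fst.
- by apply: (measurableT_comp (measurable_tnth i)); exact: measurable_snd.
Qed.

Definition tf_expi xi y : R[i] := expi (2 * pi * tuple_dot xi y).

Lemma normc_expi (t : R) : normc (expi t) = 1.
Proof. by rewrite /= cos2Dsin2 sqrtr1. Qed.

Lemma expi_conjM (t : R) : expi t * (expi t)^*%R = 1.
Proof.
rewrite /expi; apply/eqP; rewrite eq_complex /=.
by apply/andP; split; apply/eqP; [rewrite -(cos2Dsin2 t); ring|ring].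
Qed.

Lemma normc_conj (a : R[i]) : normc a^*%R = normc a.
Proof. by case: a => a b /=; rewrite sqrrN. Qed.

Lemma conjcMK (a b : R[i]) : ((a^* * b)^* = a * b^*)%R.
Proof. by rewrite rmorphM/= conjCK. Qed.

Lemma measurable_tf_expi :
  complex_measurable setT (fun p : V * V => tf_expi p.1 p.2).
Proof.
have m2 : measurable_fun setT (fun p : V * V => 2 * pi * tuple_dot p.1 p.2).
  by apply: measurable_funM => //; exact: measurable_tuple_dot.
split.
- by apply: measurableT_comp m2; apply: continuous_measurable_fun; exact: continuous_cos.
- by apply: measurableT_comp m2; apply: continuous_measurable_fun; exact: continuous_sin.
Qed.

Lemma measurable_tf_expir xi : complex_measurable setT (tf_expi xi).
Proof.
have [m1 m2] := measurable_tf_expi.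
by split; [exact: (measurable_fun_pair2 xi m1)|exact: (measurable_fun_pair2 xi m2)].
Qed.

Lemma L2fun_translation_lty x f : f \in L2fun mu ->
  (\int[mu]_y (normc (f (tuple_sub y x)) ^+ 2)%:E < +oo)%E.
Proof.
move=> /L2funP[mf If].
rewrite (ge0_integral_tuple_translation x (f := fun y => (normc (f y) ^+ 2)%:E)) //.
- exact: measurable_normc2.
- by move=> t; rewrite lee_fin sqr_ge0.
Qed.

Lemma L2fun_tf_shift x xi f : f \in L2fun mu ->
  (fun y => tf_expi xi y * f (tuple_sub y x)) \in L2fun mu.
Proof.
move=> Lf; have /L2funP[mf _] := Lf; apply/L2funP; split.
  apply: complex_measurableM; first exact: measurable_tf_expir.
  by apply: complex_measurable_comp mf; exact: measurable_tuple_subl.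
under eq_integral do rewrite Normc.normcM normc_expi mul1r.
exact: L2fun_translation_lty.
Qed.

(** The explicit formula of pi(z)^* on functions; subtracting [tuple_opp z.1] amounts to adding
    [z.1]. *)
Definition tf_unshift (z : V * V) f y : R[i] :=
  (tf_expi z.2 (tuple_sub y (tuple_opp z.1)))^* * f (tuple_sub y (tuple_opp z.1)).

(** [f] is measurable for the product sigma-algebra, so it can be composed with the measurable map
    sending (z, y) to y + x, where x is the first component of z. *)
Lemma measurable_tf_unshift f : complex_measurable setT f ->
  complex_measurable setT (fun p : (V * V) * V => tf_unshift p.1 f p.2).
Proof.
move=> mf.
have ms : measurable_fun setT
    (fun p : (V * V) * V => tuple_sub p.2 (tuple_opp p.1.1)).
  apply/measurable_fun_tnthP => i.
  rewrite (_ : _ \o _ = (fun p : (V * V) * V => tnth p.2 i + tnth p.1.1 i)); last first.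
    by apply/funext => p; rewrite /= !tnth_mktuple opprK.
  apply: measurable_funD; apply: (measurableT_comp (measurable_tnth i)).
  - exact: measurable_snd.
  - by apply: measurableT_comp; exact: measurable_fst.
apply: complex_measurableM; last exact: complex_measurable_comp mf.
apply: complex_measurableJ; have [m1 m2] := measurable_tf_expi.
have mp : measurable_fun setT (fun p : (V * V) * V =>
    (p.1.2, tuple_sub p.2 (tuple_opp p.1.1))).
  apply: measurable_fun_pair => //; apply: (measurableT_comp measurable_snd).
  exact: measurable_fst.
by split; [exact: (measurableT_comp m1 mp)|exact: (measurableT_comp m2 mp)].
Qed.

Lemma L2fun_tf_unshift z f : f \in L2fun mu -> tf_unshift z f \in L2fun mu.
Proof.
move=> Lf; have /L2funP[mf _] := Lf; apply/L2funP; split.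
  have [m1 m2] := measurable_tf_unshift mf.
  by split; [exact: (measurable_fun_pair2 z m1)|exact: (measurable_fun_pair2 z m2)].
under eq_integral do rewrite Normc.normcM normc_conj normc_expi mul1r.
exact: L2fun_translation_lty.
Qed.

End complex_translation.

(** * The adjoint of pi(z) and the measurability of Q_S f *)

Section tf_adjoint.
Variables (R : realType) (n : nat).
Local Notation V := (Rtuple R n).
Local Notation H := (L2R R n).
Local Notation mu := (@lebesgue_tuple R n).
Implicit Types (z : phase_space R n) (u v w : H).

Lemma inner_tf_shift z u v :
  inner (tf_shift z u) v = inner u (to_L2 mu (tf_unshift z (repr v))).
Proof.
have Lu : (repr u : V -> R[i]) \in L2fun mu by exact: valP.
have Lv : (repr v : V -> R[i]) \in L2fun mu by exact: valP.
have Ls := L2fun_tf_shift z.1 z.2 Lu.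
rewrite inner_to_L2r; last exact: L2fun_tf_unshift.
rewrite /tf_shift inner_to_L2l//.
(* Substitution of y + x for y, where x is [z.1]. *)
rewrite -[LHS](complex_integral_translation (tuple_opp z.1)).
  congr complex_integral; apply/funext => y.
  rewrite tuple_subNK /tf_unshift /tf_expi. by rewrite conjcMK; ring.
apply: complex_measurableM; first by have /L2funP[] := Ls.
by apply: complex_measurableJ; have /L2funP[] := Lv.
Qed.

(** [adjoint] is a choice: the explicit formula shows that there is something to choose, and a
    vector is determined by its inner products, so the choice can only be that formula. *)
Lemma adjoint_tf_shift z v :
  adjoint (tf_shift z) v = to_L2 mu (tf_unshift z (repr v)).
Proof.
rewrite /adjoint; set P := [set w | _].
have /(xgetPex 0) Pw : exists w, P w by eexists => u; exact: inner_tf_shift.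
by apply: inner_inj => w; rewrite -inner_tf_shift -Pw.
Qed.

Lemma inner_adjoint_tf_shift z u v :
  inner u (adjoint (tf_shift z) v) = inner (tf_shift z u) v.
Proof. by rewrite adjoint_tf_shift inner_tf_shift. Qed.

(** The phases have modulus 1 and Lebesgue measure is translation invariant. This makes the bound on
    Q_S uniform in [z]. *)
Lemma adjoint_tf_shift_isometry z v :
  inner (adjoint (tf_shift z) v) (adjoint (tf_shift z) v) = inner v v.
Proof.
have Lv : (repr v : V -> R[i]) \in L2fun mu by exact: valP.
have /L2funP[mv _] := Lv.
rewrite adjoint_tf_shift inner_to_L2; do ?exact: L2fun_tf_unshift.
rewrite -[RHS](complex_integral_translation (tuple_opp z.1)); last first.
  by apply: complex_measurableM => //; exact: complex_measurableJ.
congr complex_integral; apply/funext => y; rewrite /tf_unshift /tf_expi.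
rewrite conjcMK mulrACA [X in X * _]mulrC.
by rewrite -[RHS]mul1r; congr (_ * _); exact: expi_conjM.
Qed.

(** Deduced from the adjoint relation, because [repr] is additive only almost everywhere. *)
Lemma adjoint_tf_shiftP z a u v :
  adjoint (tf_shift z) (a *: u + v) =
  a *: adjoint (tf_shift z) u + adjoint (tf_shift z) v.
Proof.
pose dot := (@inner _ _ R mu : {dot H for Num.conj}).
apply: inner_inj => w; rewrite inner_adjoint_tf_shift.
rewrite ![inner _ (_ + _)](linearDr dot) /= ![inner _ (_ *: _)](linearZr_LR dot) /=.
by rewrite !inner_adjoint_tf_shift.
Qed.

Lemma Q_adjoint (S : H -> H) u z :
  Q S u z = inner (S (adjoint (tf_shift z) u)) (adjoint (tf_shift z) u).
Proof. by rewrite /Q /alpha inner_adjoint_tf_shift. Qed.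

(** Borel sets are Caratheodory measurable, so product measurability passes to the completed
    sigma-algebra. *)
Lemma measurable_phase_space (f : V * V -> R) :
  measurable_fun setT f -> measurable_fun setT (f : phase_space R n -> R).
Proof.
move=> mf _ B mB; rewrite setTI; apply: caratheodory_measurable_mu_ext.
by rewrite -[X in measurable X]setTI; exact: mf.
Qed.

Lemma measurable_Q (S : H -> H) u :
  (forall v w, inner (S v) w = inner v (S w)) ->
  complex_measurable setT (Q S u).
Proof.
move=> symS.
pose A (p : V * V) : H := to_L2 mu (tf_unshift p (repr u)).
have Lu : (repr u : V -> R[i]) \in L2fun mu by exact: valP.
have /L2funP[mu' _] := Lu.
have [m1 m2] := measurable_tf_unshift mu'.
have mA (psi : V * V -> H) :
    (forall w, complex_measurable setT (fun p : V * V => inner w (psi p))) ->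
    complex_measurable setT (fun p : V * V => inner (A p) (psi p)).
  move=> mpsi.
  have LA p : tf_unshift p (repr u) \in L2fun mu by exact: L2fun_tf_unshift.
  have := measurable_inner m1 m2 LA mpsi.
  exact.
(* First use of [mA], with a constant family. *)
have mAw w : complex_measurable setT (fun p : V * V => inner (A p) w).
  by apply: (mA (cst w)) => w'; exact: (complex_measurable_cst (inner w' w)).
(* Symmetry moves [S] onto the fixed vector [w], which reduces this to [mAw]; then [mA] applies to
   [S \o A]. *)
have mwA w : complex_measurable setT (fun p : V * V => inner w (S (A p))).
  rewrite (_ : (fun _ => _) = (fun p : V * V => (inner (A p) (S w))^*)).
    by apply: complex_measurableJ; exact: mAw.
  by apply/funext => p; rewrite -symS inner_conj.
have [mQ1 mQ2] := mA (S \o A) mwA.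
rewrite (_ : Q S u = (fun p => inner (A p) (S (A p)))).
  by split; exact: measurable_phase_space.
by apply/funext => z; rewrite Q_adjoint adjoint_tf_shift symS.
Qed.

End tf_adjoint.

(** * Completeness of L^2 and uniform boundedness *)

Section L2_norm.
Context d (T : measurableType d) (R : realType).
Variable mu : {measure set T -> \bar R}.
Implicit Types (u v w : L2 mu) (f g : T -> R[i]).
Local Notation dot := (@inner d T R mu : {dot L2 mu for Num.conj}).

Definition L2sqn u : R := Re (inner u u).
Definition L2nrm u : R := Num.sqrt (L2sqn u).

Lemma inner_sqn u : inner u u = (L2sqn u)%:C.
Proof.
have : 0 <= inner u u := dnorm_ge0 dot u; rewrite /L2sqn.
by case: (inner u u) => a b; rewrite lecE => /andP[/eqP /= -> _].
Qed.

Lemma L2sqn_ge0 u : 0 <= L2sqn u.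
Proof. by rewrite -lecR -inner_sqn; exact: (dnorm_ge0 dot u). Qed.

Lemma L2nrm_ge0 u : 0 <= L2nrm u. Proof. exact: sqrtr_ge0. Qed.

Lemma L2nrm2 u : L2nrm u ^+ 2 = L2sqn u.
Proof. by rewrite sqr_sqrtr// L2sqn_ge0. Qed.

Lemma L2_normE u : `|u| = (L2nrm u)%:C.
Proof.
rewrite -[LHS]/(L2norm u) /L2norm inner_sqn -L2nrm2 rmorphXn /= sqrCK//.
by rewrite lecR L2nrm_ge0.
Qed.

Lemma norm_normc (z : R[i]) : `|z| = (normc z)%:C. Proof. by case: z. Qed.

Lemma L2nrmD u v : L2nrm (u + v) <= L2nrm u + L2nrm v.
Proof. by rewrite -lecR rmorphD /= -!L2_normE; exact: ler_normD. Qed.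

Lemma L2nrmZ (a : R[i]) u : L2nrm (a *: u) = normc a * L2nrm u.
Proof. by apply: complexI; rewrite rmorphM /= -!L2_normE -norm_normc; exact: normrZ. Qed.

Lemma L2_CauchySchwarz u v : normc (inner u v) <= L2nrm u * L2nrm v.
Proof.
by rewrite -lecR -norm_normc rmorphM /= -!L2_normE; exact: inner_CauchySchwarz.
Qed.

Lemma to_L2_linear (a : R[i]) f g : f \in L2fun mu -> g \in L2fun mu ->
  to_L2 mu (fun x => a * f x + g x) = a *: to_L2 mu f + to_L2 mu g.
Proof.
move=> Lf Lg; rewrite /to_L2 -pi_L2P; congr (\pi_(L2 mu) _); apply: val_inj.
have [L0 LZ] := L2fun_submod_closed mu; have Lfg := LZ a f g Lf Lg.
rewrite /= insubdK//.
have EF : L2val (insubd 0 f : L2pre mu) = f by exact: insubdK.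
have EG : L2val (insubd 0 g : L2pre mu) = g by exact: insubdK.
apply/funext => x.
by have := L2valD (a *: insubd 0 f) (insubd 0 g : L2pre mu) x; rewrite L2valZ EF EG.
Qed.

Lemma L2sqn_to_L2 f : f \in L2fun mu ->
  (L2sqn (to_L2 mu f))%:E = (\int[mu]_x (normc (f x) ^+ 2)%:E)%E.
Proof.
move=> Lf; have /L2funP[mf If] := Lf.
rewrite /L2sqn inner_to_L2// Re_complex_integral /Rintegral fineK; last first.
  by apply: integrable_fin_num => //; have [] := complex_integrable_L2 Lf Lf.
by apply: eq_integral => x _; congr (_%:E); rewrite normc2E Defs.ReM Defs.ReJ Defs.ImJ; ring.
Qed.

Lemma L2sqn_to_L2B f g : f \in L2fun mu -> g \in L2fun mu ->
  (L2sqn (to_L2 mu f - to_L2 mu g))%:E =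
  (\int[mu]_x (normc (f x - g x) ^+ 2)%:E)%E.
Proof.
move=> Lf Lg; rewrite addrC -scaleN1r -to_L2_linear// L2sqn_to_L2.
  by apply: eq_integral => x _; rewrite mulN1r addrC.
by have [_ LZ] := L2fun_submod_closed mu; exact: LZ.
Qed.

Lemma L2sqnB u v : (L2sqn (u - v))%:E =
  (\int[mu]_x (normc (repr u x - repr v x) ^+ 2)%:E)%E.
Proof. by rewrite -L2sqn_to_L2B ?to_L2_repr//; exact: valP. Qed.

End L2_norm.

Lemma cvg_geometric_steps (R : realType) (a : nat -> R) (L : R) :
  (forall k, `|a k.+1 - a k| <= L * 2^-1 ^+ k) -> cvgn a.
Proof.
move=> aL; have L0 : 0 <= L.
  by have := aL 0%N; rewrite expr0 mulr1; exact: le_trans.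
have -> : a = cst (a 0%N) \+ series (telescope a).
  by apply/funext => n; rewrite [LHS]eq_sum_telescope.
apply: is_cvgD; first exact: is_cvg_cst.
apply: normed_cvg; apply: (@series_le_cvg _ _ (geometric L 2^-1)) => //.
- by move=> n; exact: normr_ge0.
- by move=> n; apply: mulr_ge0 => //; exact: exprn_ge0.
- apply: is_cvg_geometric_series.
  by rewrite ger0_norm ?invr_ge0// invf_lt1 ?ltr1n.
Qed.

Lemma geometric_sum_le (R : realType) (q : R) n : 0 <= q -> q < 1 ->
  \sum_(0 <= k < n) q ^+ k <= (1 - q)^-1.
Proof.
move=> q0 q1; have q2 : 0 < 1 - q by rewrite subr_gt0.
rewrite -[leRHS]mul1r ler_pdivlMr//.
suff -> : (\sum_(0 <= k < n) q ^+ k) * (1 - q) = 1 - q ^+ n.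
  by rewrite lerBlDr lerDl exprn_ge0.
elim: n => [|n ih]; first by rewrite big_nil expr0 subrr mul0r.
by rewrite big_nat_recr//= mulrDl ih exprSr; ring.
Qed.

Lemma limn_einf_le (R : realType) (u : nat -> \bar R) (M : \bar R) :
  (forall n, u n <= M)%E -> (limn_einf u <= M)%E.
Proof.
move=> uM; rewrite limn_einf_lim; apply: lime_le; first exact: is_cvg_einfs.
apply: nearW => n; apply: le_trans (uM n).
by apply: ereal_inf_lbound; exists n => /=.
Qed.

(** * Riesz-Fischer for sequences with a geometric rate *)

Section L2_complete.
Context d (T : measurableType d) (R : realType).
Variable mu : {measure set T -> \bar R}.
Variables (v_ : nat -> L2 mu) (C : R).
Hypothesis v_cauchy : forall k i,
  L2sqn (v_ (k + i)%N - v_ k) <= C * 9^-1 ^+ k.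

Let F k : T -> R[i] := repr (v_ k).

Let LF k : F k \in L2fun mu. Proof. exact: valP. Qed.

Let mF k : complex_measurable setT (F k).
Proof. by have /L2funP[] := LF k. Qed.

Let C_ge0 : 0 <= C.
Proof.
have := v_cauchy 0 0; rewrite expr0 mulr1; apply: le_trans; exact: L2sqn_ge0.
Qed.

Let mFB k j : complex_measurable setT (fun x => F k x - F j x).
Proof. exact: complex_measurableB. Qed.

(* Since [9/4 > 1], the weights [4^k] keep the series integrable, and they make
   the increments [O(2^-k)] almost everywhere. *)
Let term k x : \bar R := ((4 ^+ k) * normc (F k.+1 x - F k x) ^+ 2)%:E.

Let term_ge0 k x : (0 <= term k x)%E.
Proof. by rewrite lee_fin mulr_ge0 ?sqr_ge0// exprn_ge0. Qed.

Let mterm k : measurable_fun setT (term k).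
Proof.
apply/measurable_EFinP/measurable_funM => //.
by apply/measurable_EFinP; exact: measurable_normc2.
Qed.

(** The integral of the series is at most C times a geometric series of ratio 4/9, so its sum is
    finite almost everywhere. Each term is at most the sum, whose square root serves as the
    constant. *)
Let steps_ae : {ae mu, forall x, exists K : R, 0 <= K /\
  forall k, normc (F k.+1 x - F k x) <= K * 2^-1 ^+ k}.
Proof.
have mS : measurable_fun setT (fun x => \sum_(0 <= k <oo) term k x)%E.
  exact: (ge0_emeasurable_sum (P := predT)).
have iS : mu.-integrable setT (fun x => \sum_(0 <= k <oo) term k x)%E.
  apply/integrableP; split => //.
  under eq_integral do rewrite gee0_abs ?nneseries_ge0//.
  rewrite integral_nneseries//.
  apply: (@le_lt_trans _ _ (C * (1 - 4 / 9)^-1)%:E); last by rewrite ltry.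
  apply: lime_le; first by apply: is_cvg_nneseries => *; exact: integral_ge0.
  apply: nearW => n.
  apply: (@le_trans _ _ (\sum_(0 <= k < n) (C * (4 / 9) ^+ k)%:E)%E); last first.
    rewrite sumEFin lee_fin -mulr_sumr ler_wpM2l ?C_ge0// geometric_sum_le//.
    by lra.
  apply: lee_sum => k _; rewrite /term.
  under eq_integral do rewrite EFinM.
  rewrite ge0_integralZl//; last 2 first.
    exact: measurable_normc2.
    by move=> x _; rewrite lee_fin sqr_ge0.
  rewrite -L2sqnB -EFinM lee_fin exprMn [_ * (_ * _)]mulrCA ler_wpM2l//.
  by rewrite -[k.+1]addn1; exact: v_cauchy.
apply: filterS (integrable_ae measurableT iS) => x /(_ Logic.I) Sfin.
set K := fine (\sum_(0 <= k <oo) term k x)%E.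
have K0 : 0 <= K by rewrite fine_ge0// nneseries_ge0.
exists (Num.sqrt K); split; first exact: sqrtr_ge0.
move=> k; rewrite -[leLHS](ger0_norm (normc_ge0 _)) -sqrtr_sqr.
rewrite -[2^-1 ^+ k](ger0_norm (exprn_ge0 _ _))// -sqrtr_sqr -sqrtrM// ler_wsqrtr//.
rewrite exprAC exprVn [_ ^+ k]exprVn ler_pdivlMr ?exprn_gt0//.
rewrite -lee_fin /K fineK//.
apply: (@le_trans _ _ (\sum_(0 <= i < k.+1) term i x)%E); last exact: nneseries_lim_ge.
rewrite big_nat_recr//= -[leLHS]add0e (_ : 2 ^+ 2 = 4 :> R); last by rewrite expr2 -natrM.
by rewrite mulrC; apply: leeD; [apply: sume_ge0 => i _; exact: term_ge0|].
Qed.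

(** The upper limit exists at every point and is measurable, and it is the limit wherever there is
    one; [fine] replaces infinite values by 0, which happens only on a null set. *)
Let Fre x : R := fine (limn_esup (fun k => (Re (F k x))%:E)).
Let Fim x : R := fine (limn_esup (fun k => (Im (F k x))%:E)).
Let Flim x : R[i] := Fre x +i* Fim x.

Let Flim_cvg : {ae mu, forall x, Re (F k x) @[k --> \oo] --> Fre x /\
  Im (F k x) @[k --> \oo] --> Fim x}.
Proof.
have esup_cvg (a : nat -> R) : cvgn a -> a @ \oo --> fine (limn_esup (EFin \o a)).
  move=> ca; have ca' : (EFin \o a) @ \oo --> (limn a)%:E.
    by apply: cvg_EFin => //; exact: nearW.
  by rewrite (cvg_limn_einf_sup ca').2.
apply: filterS steps_ae => x [K [K0 FK]]; split; apply: esup_cvg;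
  apply: (@cvg_geometric_steps _ _ K) => k; apply: le_trans (FK k).
- apply: le_trans (le_Re_normc _).
  by case: (F k x) => a b; case: (F k.+1 x).
- apply: le_trans (le_Im_normc _).
  by case: (F k x) => a b; case: (F k.+1 x).
Qed.

Let mFlim : complex_measurable setT Flim.
Proof.
split.
- apply: (@measurableT_comp _ _ _ _ _ _ fine) => //.
  by apply: measurable_fun_limn_esup => k; apply/measurable_EFinP; case: (mF k).
- apply: (@measurableT_comp _ _ _ _ _ _ fine) => //.
  by apply: measurable_fun_limn_esup => k; apply/measurable_EFinP; case: (mF k).
Qed.

(** Fatou's lemma for |F (k + i) - F k|^2 as i grows: every integral obeys the bound [v_cauchy], and
    the lower limit is almost everywhere the integrand on the left. *)
Let FlimB_le k :
  (\int[mu]_x (normc (Flim x - F k x) ^+ 2)%:E <= (C * 9^-1 ^+ k)%:E)%E.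
Proof.
pose f i x : \bar R := (normc (F (k + i)%N x - F k x) ^+ 2)%:E.
have mf i : measurable_fun setT (f i) by exact: measurable_normc2.
have f0 i x : (0 <= f i x)%E by rewrite lee_fin sqr_ge0.
have := fatou mu measurableT mf (fun i x _ => f0 i x).
have mlim : complex_measurable setT (fun x => Flim x - F k x).
  exact: complex_measurableB.
have -> : (\int[mu]_x limn_einf (f^~ x) =
    \int[mu]_x (normc (Flim x - F k x) ^+ 2)%:E)%E.
  apply: ae_eq_integral => //.
  (* The lower limit is minus the upper limit of the opposites. *)
  - have mesup : measurable_fun setT (fun x => limn_esup (fun i => - f i x)%E).
      apply: measurable_fun_limn_esup => i; exact: measurableT_comp.
    exact: (measurableT_comp (oppe_measurable (D := setT)) mesup).
  - exact: measurable_normc2.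
  - apply: filterS Flim_cvg => x [c1 c2] _.
    suff : f^~ x @ \oo --> (normc (Flim x - F k x) ^+ 2)%:E.
      by move=> /cvg_limn_einf_sup[].
    apply: cvg_EFin; first exact: nearW.
    rewrite (_ : _ \o _ = (fun i => (Re (F (i + k)%N x) - Re (F k x)) ^+ 2 +
       (Im (F (i + k)%N x) - Im (F k x)) ^+ 2)); last first.
      apply/funext => i; rewrite /f /= addnC normc2E.
      by case: (F (i + k)%N x) => ? ?; case: (F k x).
    rewrite normc2E (_ : Re (Flim x - F k x) = Fre x - Re (F k x)); last by case: (F k x).
    rewrite (_ : Im (Flim x - F k x) = Fim x - Im (F k x)); last by case: (F k x).
    have c1' : Re (F (i + k)%N x) @[i --> \oo] --> Fre x.
      by rewrite (cvg_shiftn k (fun i => Re (F i x))).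
   
    have c2' : Im (F (i + k)%N x) @[i --> \oo] --> Fim x.
      by rewrite (cvg_shiftn k (fun i => Im (F i x))).
   
    by apply: cvgD; apply: cvgM; apply: cvgB => //; exact: cvg_cst.
move=> /le_trans; apply; apply: limn_einf_le => i.
by rewrite /f -L2sqnB lee_fin; exact: v_cauchy.
Qed.

Lemma L2_complete : exists v, forall k, L2sqn (v - v_ k) <= C * 9^-1 ^+ k.
Proof.
have [L0 LZ] := L2fun_submod_closed mu.
(* The case k = 0 of the bound makes Flim - F 0 square integrable, and adding F 0 back gives
   [Flim]. *)
have LD : (fun x => Flim x - F 0%N x) \in L2fun mu.
  apply/L2funP; split; first exact: complex_measurableB.
  by apply: le_lt_trans (FlimB_le 0) _; rewrite ltry.
have LFlim : Flim \in L2fun mu.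
  have -> : Flim = 1 *: ((fun x => Flim x - F 0%N x) : T -> R[i]) + F 0%N.
    by apply/funext => x; rewrite scale1r -[RHS]/(Flim x - F 0%N x + F 0%N x) subrK.
  exact: LZ.
exists (to_L2 mu Flim) => k.
by rewrite -lee_fin -[v_ k]to_L2_repr L2sqn_to_L2B//; [exact: FlimB_le|exact: LF].
Qed.

End L2_complete.

(** * The uniform boundedness principle in L^2 *)

Section uniform_boundedness.
Context d (T : measurableType d) (R : realType).
Variable mu : {measure set T -> \bar R}.
Implicit Types (u v w : L2 mu).
Local Notation dot := (@inner d T R mu : {dot L2 mu for Num.conj}).

Lemma innerDl u v w : inner (u + v) w = inner u w + inner v w.
Proof. exact: (linearDl dot). Qed.

Lemma innerBl u v w : inner (u - v) w = inner u w - inner v w.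
Proof. exact: (linearBl dot). Qed.

Lemma innerZl (a : R[i]) u v : inner (a *: u) v = a * inner u v.
Proof. exact: (linearZl_LR dot). Qed.

Lemma innerDr u v w : inner w (u + v) = inner w u + inner w v.
Proof. exact: (linearDr dot). Qed.

Lemma innerBr u v w : inner w (u - v) = inner w u - inner w v.
Proof. exact: (linearBr dot). Qed.

Lemma innerZr (a : R[i]) u v : inner v (a *: u) = (a^* * inner v u)%R.
Proof. exact: (linearZr_LR dot). Qed.

Lemma L2nrmN u : L2nrm (- u) = L2nrm u.
Proof. by apply: complexI; rewrite -!L2_normE normrN. Qed.

(* Sokal's proof: of the two vectors [v + w] and [v - w], at least one has an
   inner product with [g] of modulus at least [|<g, w>|]. If
   [|g_k| > 2 (k+1) 3^k] for all [k], adding such steps of lengths [3^-k] along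
   [g_k] produces a [v] with [|<g_k, v>| > k+1] for all [k]. *)
Let sokal_step g v w : L2 mu :=
  if normc (inner g w) <= normc (inner g (v + w)) then v + w else v - w.

(** The inner products of [g] with [v + w] and [v - w] differ by 2 <g, w>, so they cannot both have
    modulus below |<g, w>|. *)
Let sokal_step_ge g v w : normc (inner g w) <= normc (inner g (sokal_step g v w)).
Proof.
rewrite /sokal_step; case: ifPn => //; rewrite -ltNge => lt_p.
rewrite leNgt; apply/negP => lt_m.
have := le_normcD (inner g (v + w)) (- inner g (v - w)).
rewrite normcN.
rewrite (_ : _ - _ = inner g w + inner g w); last by rewrite innerBr innerDr; ring.
rewrite -mulr2n normcMn.
by rewrite mulr2n leNgt ltrD.
Qed.

Let sokal_step_dist g v w : L2nrm (sokal_step g v w - v) = L2nrm w.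
Proof.
rewrite /sokal_step; case: ifP => _; first by rewrite addrAC subrr add0r.
by rewrite addrAC subrr add0r L2nrmN.
Qed.

Lemma L2_uniform_boundedness (g_ : nat -> L2 mu) :
  (forall v, exists M : R, forall n, normc (inner (g_ n) v) <= M) ->
  exists M : R, forall n, L2nrm (g_ n) <= M.
Proof.
move=> g_bnd; apply: contrapT => nbnd.
pose c k : R := 3^-1 ^+ k.
have c0 k : 0 < c k by rewrite exprn_gt0.
have cS k : c k.+1 = c k / 3 by rewrite /c exprSr.
have /choice[n_ n_P] : forall k, exists n, 2 * k.+1%:R / c k < L2nrm (g_ n).
  move=> k; apply: contrapT => nP; apply: nbnd; exists (2 * k.+1%:R / c k) => n.
  by rewrite leNgt; apply/negP => lt_n; apply: nP; exists n.
pose g k := g_ (n_ k); pose N k := L2nrm (g k).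
have N0 k : 0 < N k.
  by apply: le_lt_trans (n_P k); rewrite divr_ge0 ?mulr_ge0// ltW.
pose w k := ((c k / N k)%:C *: g k).
have wN k : L2nrm (w k) = c k.
  rewrite L2nrmZ normc_real ger0_norm ?divr_ge0 ?ltW//.
  by rewrite -/(N k) divfK// gt_eqF.
have gw k : normc (inner (g k) (w k)) = c k * N k.
  rewrite innerZr inner_sqn -L2nrm2 -/(N k).
  rewrite -[_^*%R]/((c k / N k)%:C^*) conjc_real -rmorphM normc_real.
  rewrite ger0_norm; last by rewrite mulr_ge0 ?sqr_ge0// divr_ge0 ?ltW.
  by rewrite expr2 mulrA divfK// gt_eqF.
pose v_ := fix v_ k := if k is k'.+1 then sokal_step (g k') (v_ k') (w k') else 0.
have v_ge k : c k * N k <= normc (inner (g k) (v_ k.+1)).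
  by rewrite -gw; exact: sokal_step_ge.
(* The right-hand side is the exact sum of the step lengths c k, ..., c (k + i - 1). *)
have v_dist k i : L2nrm (v_ (k + i)%N - v_ k) <= 3 / 2 * (c k - c (k + i)%N).
  elim: i => [|i ih].
    rewrite addn0 !subrr mulr0 -(scale0r (0 : L2 mu)) L2nrmZ normc_real.
    by rewrite normr0 mul0r.
  rewrite addnS -(subrKA (v_ (k + i)%N)); apply: le_trans (L2nrmD _ _) _.
  have := sokal_step_dist (g (k + i)%N) (v_ (k + i)%N) (w (k + i)%N).
  rewrite -/(v_ (k + i).+1) wN => ->.
  by rewrite cS; lra.
have c32 k : 0 <= 3 / 2 * c k by have := c0 k; lra.
have c2 k : (3 / 2 * c k) ^+ 2 = 9 / 4 * 9^-1 ^+ k.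
  by rewrite exprMn /c exprAC; congr (_ * _ ^+ k); lra.
have v_cauchy k i : L2sqn (v_ (k + i)%N - v_ k) <= 9 / 4 * 9^-1 ^+ k.
  rewrite -L2nrm2 -c2 ler_sqr ?nnegrE ?L2nrm_ge0//.
  by apply: le_trans (v_dist k i) _; have := c0 (k + i)%N; lra.
have [v v_lim] := L2_complete v_cauchy.
have v_lim' k : L2nrm (v - v_ k) <= 3 / 2 * c k.
  by rewrite -ler_sqr ?nnegrE ?L2nrm_ge0// L2nrm2 c2.
have [M gM] := g_bnd v.
pose k := (Num.truncn `|M|).+1.
have kM : `|M| < k%:R by rewrite truncnS_gt.
have := gM (n_ k); rewrite -/(g k); apply/negP; rewrite -ltNge.
have lt1 : k.+1%:R < 2^-1 * (c k * N k).
  have := n_P k; rewrite -/(g k) -/(N k) ltr_pdivrMr// => lt2.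
  by lra.
(* All steps after the one along [g k] have total length at most 3/2 c (k + 1) = c k / 2. They undo
   at most half of [c k * N k], and by [lt1] the other half already exceeds k + 1 > M. *)
have lt2 : c k * N k <= normc (inner (g k) v) + N k * (3 / 2 * (c k / 3)).
  apply: le_trans (v_ge k) _.
  have -> : v_ k.+1 = v - (v - v_ k.+1) by rewrite opprB addrC subrK.
  rewrite innerBr; apply: le_trans (le_normcD _ _) _; rewrite lerD2l.
  rewrite normcN.
  apply: le_trans (L2_CauchySchwarz _ _) _; rewrite ler_wpM2l ?L2nrm_ge0//.
  by rewrite -cS; exact: v_lim'.
have Mk : M < k.+1%:R.
  by apply: le_lt_trans (ler_norm _) _; apply: lt_trans kM _; rewrite ltr_nat.
by lra.
Qed.

End uniform_boundedness.

(** * Compact operators and weak convergence *)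

Section compact_quadratic_form.
Context d (T : measurableType d) (R : realType).
Variable mu : {measure set T -> \bar R}.
Implicit Types (u v w : L2 mu).

(** The balls of radius [e] around all vectors cover the compact closure of the image; the centres
    of a finite subcover form the net, and they need not lie in the image. *)
Lemma compact_operator_net (H : L2 mu -> L2 mu) (e : R) : compact_operator H ->
  0 < e -> exists s : seq (L2 mu), forall u, L2nrm u <= 1 ->
    exists2 w, w \in s & L2nrm (H u - w) < e.
Proof.
rewrite /compact_operator precompactE compact_cover => cH e0.
set B := [set u : L2 mu | `|u| <= 1] in cH.
have e0C : 0 < e%:C by rewrite ltcR.
have [||D _ DB] := cH (L2 mu) setT (fun w => ball w e%:C).
- by move=> w _; exact: ball_open.
- by move=> w _; exists w => //; exact: ballxx.
exists (finmap.enum_fset D) => u u1.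
have : closure (H @` B) (H u).
  apply: subset_closure; exists u => //.
  by rewrite /B /= L2_normE lecR.
move=> /DB[w Dw]; rewrite -ball_normE /= => wHu; exists w => //.
by rewrite -ltcR -L2_normE distrC.
Qed.

Lemma weak_cvgB (u_ : nat -> L2 mu) u v (e : R) : weak_cvg u_ u -> 0 < e ->
  \forall n \near \oo, normc (inner (u_ n - u) v) < e.
Proof.
move=> /(_ v) /cvgrPdist_lt uv e0.
have e0C : 0 < e%:C by rewrite ltcR.
apply: filterS (uv _ e0C) => n.
by rewrite -ltcR -norm_normc innerBl distrC.
Qed.

Lemma weak_cvg_bounded (u_ : nat -> L2 mu) u : weak_cvg u_ u ->
  exists M : R, forall n, L2nrm (u_ n - u) <= M.
Proof.
move=> uu; apply: L2_uniform_boundedness => v.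
have [N _ NP] := weak_cvgB v uu ltr01.
(* The tail stays below 1, and each of the first [N] terms is at most their sum. *)
exists (\sum_(i < N) normc (inner (u_ i - u) v) + 1) => n.
have [Nn|nN] := leqP N n.
  by apply: ltW; apply: lt_le_trans (NP n Nn) _; rewrite lerDr sumr_ge0// => i _; exact: normc_ge0.
rewrite (bigD1 (Ordinal nN))//= -addrA lerDl addr_ge0// sumr_ge0// => i _.
Qed.

(** [H (u_ n - u)] varies with [n], so weak convergence cannot be tested on it directly. The net
    replaces it by finitely many fixed vectors, on which weak convergence is uniform. *)
Lemma compact_weak_cvg (H : {linear L2 mu -> L2 mu}) (u_ : nat -> L2 mu) u (e : R) :
  compact_operator H -> weak_cvg u_ u -> 0 < e ->
  \forall n \near \oo, normc (inner (H (u_ n - u)) (u_ n - u)) < e.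
Proof.
move=> cH uu e0; have [M0 M0P] := weak_cvg_bounded uu.
pose M := `|M0| + 1.
have M_gt0 : 0 < M by rewrite ltr_pwDr.
have MP n : L2nrm (u_ n - u) <= M.
  by apply: le_trans (M0P n) _; apply: le_trans (ler_norm _) _; rewrite lerDl.
(* The net error is multiplied by [M] when the unit ball is rescaled, and by [M] again in the
   Cauchy-Schwarz bound. *)
have eM0 : 0 < e / 2 / (M * M) by rewrite !divr_gt0// mulr_gt0.
have [s sP] := compact_operator_net cH eM0.
have near_s : \forall n \near \oo, forall w, w \in s ->
    normc (inner (u_ n - u) w) < e / 2 / M.
  elim: s {sP} => [|w s ih]; first exact: nearW.
  have wP : \forall n \near \oo, normc (inner (u_ n - u) w) < e / 2 / M.
    by apply: weak_cvgB => //; rewrite !divr_gt0.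
  apply: filterS2 wP ih => n wn sn w'; rewrite inE => /orP[/eqP -> //|]; exact: sn.
apply: filterS near_s => n sn.
set g := u_ n - u in sn *.
have gM : L2nrm g <= M := MP n.
pose h := M^-1%:C *: g.
have h1 : L2nrm h <= 1.
  rewrite L2nrmZ normc_real gtr0_norm ?invr_gt0//.
  by rewrite ler_pdivrMl// mulr1.
have gE : g = M%:C *: h.
  by rewrite scalerA -rmorphM /= divff ?gt_eqF// scale1r.
have [w ws Hhw] := sP h h1.
have -> : H g = M%:C *: (H h - w) + M%:C *: w.
  by rewrite -scalerDr subrK {1}gE linearZ.
rewrite innerDl; apply: le_lt_trans (le_normcD _ _) _.
rewrite !innerZl !Normc.normcM normc_real (gtr0_norm M_gt0).
have b1 : normc (inner (H h - w) g) <= e / 2 / (M * M) * M.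
  apply: le_trans (L2_CauchySchwarz _ _) _.
  by apply: ler_pM; rewrite ?L2nrm_ge0// ltW.
have b2 : normc (inner w g) < e / 2 / M.
  by rewrite inner_conj normc_conj; exact: sn.
have : M * normc (inner (H h - w) g) <= e / 2.
  apply: le_trans (ler_wpM2l (ltW M_gt0) b1) _.
  suff -> : M * (e / 2 / (M * M) * M) = e / 2 by [].
  by field; rewrite gt_eqF.
have : M * normc (inner w g) < e / 2.
  by rewrite mulrC -ltr_pdivlMr.
lra.
Qed.

End compact_quadratic_form.

(** * Bounds on integrals and positive operators *)

Section Lp_bound.
Context d (T : measurableType d) (R : realType).
Variables (mu : {measure set T -> \bar R}) (D : set T).

Lemma integral_affine_le (h g : T -> R) (c k : R) : measurable D ->
  measurable_fun D h -> measurable_fun D g ->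
  (forall z, 0 <= h z) -> (forall z, 0 <= g z) -> 0 <= c -> 0 <= k ->
  (forall z, h z <= c * g z + k) ->
  (\int[mu]_(z in D) (h z)%:E <=
   c%:E * \int[mu]_(z in D) (g z)%:E + k%:E * mu D)%E.
Proof.
move=> mD mh mg h0 g0 c0 k0 hcg.
have mEg : measurable_fun D (fun z => (g z)%:E) by exact/measurable_EFinP.
apply: (@le_trans _ _ (\int[mu]_(z in D) (c%:E * (g z)%:E + k%:E))%E).
  apply: ge0_le_integral => //.
  - by move=> z _; rewrite lee_fin.
  - exact/measurable_EFinP.
  - by apply: emeasurable_funD => //; exact: measurable_funeM.
  - by move=> z _; rewrite -EFinM -EFinD lee_fin.
rewrite ge0_integralD//.
- by rewrite ge0_integralZl// ?integral_cst// => z _; rewrite lee_fin.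
- by move=> z _; rewrite -EFinM lee_fin mulr_ge0.
- exact: measurable_funeM.
Qed.

Lemma measurable_normc (F : T -> R[i]) : complex_measurable D F ->
  measurable_fun D (fun z => normc (F z)).
Proof.
move=> [mF1 mF2].
rewrite (_ : (fun _ => _) = (fun z => Num.sqrt (Re (F z) ^+ 2 + Im (F z) ^+ 2))).
  have ms : measurable_fun setT (Num.sqrt : R -> R).
    by apply: continuous_measurable_fun; exact: sqrt_continuous.
  apply: (measurableT_comp ms).
  by apply: measurable_funD; exact: measurable_funX.
by apply/funext => z; case: (F z).
Qed.

(** Since |F| <= K on [D] and p - 1 >= 0, |F|^p <= K^(p-1) |F| there, so a uniform bound and an L^1
    bound control the L^p norm. *)
Lemma Lp_norm_le (p K I : R) (F : T -> R[i]) : measurable D -> 1 <= p ->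
  complex_measurable D F -> (forall z, D z -> normc (F z) <= K) ->
  (\int[mu]_(z in D) (normc (F z))%:E <= I%:E)%E ->
  (Lp_norm mu D p F <= ((K `^ (p - 1) * I) `^ p^-1)%:E)%E.
Proof.
move=> mD p1 mF FK FI; have mN := measurable_normc mF.
have p0 : 0 < p by exact: lt_le_trans p1.
rewrite /Lp_norm unlock /= -poweR_EFin; apply: gt0_ler_poweR.
- by rewrite invr_ge0 ltW.
- rewrite in_itv /= leey andbT; apply: integral_ge0 => z _; exact: poweR_ge0.
- rewrite in_itv /= leey andbT lee_fin mulr_ge0 ?powR_ge0//.
  by rewrite -lee_fin; apply: le_trans FI; apply: integral_ge0 => z _; rewrite lee_fin normc_ge0.
rewrite (_ : (\int[mu]_z _ = \int[mu]_(z in D) (normc (F z) `^ p)%:E)%E); last first.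
  rewrite [RHS]integral_mkcond; apply: eq_integral => z _; rewrite !patchE.
  case: ifP => _; last by rewrite abse0 poweR0r// gt_eqF.
  by rewrite abse_EFin poweR_EFin ger0_norm ?normc_ge0.
apply: (@le_trans _ _ (\int[mu]_(z in D) ((K `^ (p - 1))%:E * (normc (F z))%:E))%E).
  apply: ge0_le_integral => //.
  - by move=> z _; rewrite lee_fin powR_ge0.
  - by apply/measurable_EFinP; exact: (measurableT_comp (measurable_powR p)).
  - by apply: measurable_funeM; apply/measurable_EFinP.
  - move=> z Dz; rewrite -EFinM lee_fin -(mulr_powRB1 (normc_ge0 _) p0) mulrC.
    rewrite ler_wpM2r ?normc_ge0//; apply: ge0_ler_powR => //;
      rewrite ?nnegrE ?subr_ge0 ?normc_ge0 ?FK//.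
    exact: le_trans (normc_ge0 _) (FK z Dz).
rewrite ge0_integralZl//.
- rewrite EFinM; apply: lee_pmul => //; rewrite ?lee_fin ?powR_ge0//.
  by apply: integral_ge0 => z _; rewrite lee_fin normc_ge0.
- exact/measurable_EFinP.
- by move=> z _; rewrite lee_fin normc_ge0.
- by rewrite lee_fin powR_ge0.
Qed.

End Lp_bound.

Section positive_operator.
Context d (T : measurableType d) (R : realType).
Variable mu : {measure set T -> \bar R}.
Variable S : {linear L2 mu -> L2 mu}.
Hypothesis S_pos : positive_operator S.
Implicit Types (u v w : L2 mu).

Let Im0 u : Im (inner (S u) u) = 0.
Proof. by have := S_pos u; rewrite lecE => /andP[/eqP]. Qed.

(** Polarization: that the form is real at u + v gives <S u, v> and <S v, u> opposite imaginary
    parts, and that it is real at u + i v gives them equal real parts. *)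
Lemma positive_operator_symmetric u v : inner (S u) v = inner u (S v).
Proof.
pose i : R[i] := 0 +i* 1.
have e1 := Im0 (u + v); have e2 := Im0 (u + i *: v).
move: (Im0 u) (Im0 v) e1 e2; rewrite (inner_conj u).
rewrite !linearD linearZ !innerDl !innerDr !innerZl !innerZr.
move: (inner (S u) u) (inner (S v) v) (inner (S u) v) (inner (S v) u).
move=> [a1 a2] [b1 b2] [s1 s2] [t1 t2] /= -> -> e1 e2.
by apply/eqP; rewrite eq_complex /=; apply/andP; split; apply/eqP; lra.
Qed.

Lemma quadratic_form_expand u v (s : R) :
  Re (inner (S (s%:C *: u + v)) (s%:C *: u + v)) =
  s ^+ 2 * Re (inner (S u) u) +
  2 * s * ((Re (inner (S u) v) + Re (inner (S v) u)) / 2) + Re (inner (S v) v).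
Proof.
rewrite linearD linearZ !innerDl !innerDr !innerZl !innerZr.
move: (inner (S u) u) (inner (S v) v) (inner (S u) v) (inner (S v) u).
by move=> [a1 a2] [b1 b2] [s1 s2] [t1 t2] /=; field.
Qed.

End positive_operator.

(** * The quadratic forms Q_S *)

Section Q_estimates.
Variables (R : realType) (n : nat).
Local Notation H := (L2R R n).
Variable S : {linear H -> H}.
Hypothesis S_pos : positive_operator S.
Implicit Types (z : phase_space R n) (u v : H).

Lemma Q_real u z : Q S u z = (Re (Q S u z))%:C.
Proof.
rewrite Q_adjoint; have := S_pos (adjoint (tf_shift z) u).
by case: (inner _ _) => a b; rewrite lecE => /andP[/eqP /= -> _].
Qed.

Lemma ReQ_ge0 u z : 0 <= Re (Q S u z).
Proof. by rewrite -lecR -Q_real Q_adjoint. Qed.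

Lemma ReQ_le : bounded_operator S ->
  exists2 M : R, 0 <= M & forall u z, Re (Q S u z) <= M * L2sqn u.
Proof.
move=> [M SM]; exists `|M| => // v z; rewrite Q_adjoint.
set w := adjoint (tf_shift z) v.
have -> : L2sqn v = L2nrm w ^+ 2.
  by rewrite L2nrm2 /L2sqn adjoint_tf_shift_isometry.
apply: le_trans (ler_norm _) _; apply: le_trans (le_Re_normc _) _.
apply: le_trans (L2_CauchySchwarz _ _) _.
rewrite expr2 mulrA ler_wpM2r ?L2nrm_ge0//.
have := SM w; rewrite !L2_normE -rmorphM lecR => /le_trans; apply.
by rewrite ler_wpM2r ?L2nrm_ge0// ler_norm.
Qed.

(** What matters is that one [b] serves all real [s], so that the values at 1, t and -t can be
    compared. *)
Lemma ReQ_expand u v z : exists b : R, forall s : R,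
  Re (Q S (s%:C *: u + v) z) = s ^+ 2 * Re (Q S u z) + 2 * s * b + Re (Q S v z).
Proof.
set A := adjoint (tf_shift z).
exists ((Re (inner (S (A u)) (A v)) + Re (inner (S (A v)) (A u))) / 2) => s.
by rewrite !Q_adjoint adjoint_tf_shiftP; exact: quadratic_form_expand.
Qed.

(* Expanding [0 <= Q (t u +- v)] bounds the cross term by AM-GM. *)
Lemma ReQ_dist u v z (t : R) : 0 < t ->
  `|Re (Q S (u + v) z) - Re (Q S u z)| <=
  (1 + t^-1) * Re (Q S v z) + t * Re (Q S u z).
Proof.
move=> t0; have [b bE] := ReQ_expand u v z.
have := bE (- t); have := bE t; have := bE 1; rewrite scale1r => -> ht hnt.
have := ReQ_ge0 (t%:C *: u + v) z; have := ReQ_ge0 ((- t)%:C *: u + v) z.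
rewrite ht hnt; have := ReQ_ge0 v z; have := ReQ_ge0 u z.
move: (Re (Q S u z)) (Re (Q S v z)) => {ht hnt} q r q0 r0 h1 h2.
have -> : (1 + t^-1) * r + t * q = (t ^+ 2 * q + r) / t + r by field; rewrite gt_eqF.
have b1 : 2 * b <= (t ^+ 2 * q + r) / t by rewrite ler_pdivlMr//; nra.
have b2 : - (2 * b) <= (t ^+ 2 * q + r) / t by rewrite ler_pdivlMr//; nra.
by rewrite ler_norml; apply/andP; split; lra.
Qed.

End Q_estimates.

(** * From the localization operator to convergence in L^p *)

Section Q_continuity.
Variables (R : realType) (n : nat).
Local Notation H := (L2R R n).
Local Notation mu := (phase_measure R n).
Variables (S : {linear H -> H}) (Omega : set (phase_space R n)) (A : {linear H -> H}).
Hypotheses (S_bnd : bounded_operator S) (S_pos : positive_operator S).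
Hypotheses (mOmega : measurable Omega) (Omega_fin : (mu Omega < +oo)%E).
Hypothesis locA : is_localization_operator Omega S A.
Implicit Types (z : phase_space R n) (u v f g : H).

Let mQ f : complex_measurable setT (Q S f).
Proof. by apply: measurable_Q; exact: positive_operator_symmetric. Qed.

Let mQO f : complex_measurable Omega (Q S f).
Proof. by have [m1 m2] := mQ f; split; exact: measurable_funTS. Qed.

Let mReQ f : measurable_fun Omega (fun z => Re (Q S f z)).
Proof. by have [] := mQO f. Qed.

(** The weak integral is defined through real-valued integrals, where [fine] hides infinite values;
    boundedness of Q_S g on a set of finite measure turns it into an extended-real identity. *)
Lemma integral_ReQ g :
  (\int[mu]_(z in Omega) (Re (Q S g z))%:E = (Re (inner (A g) g))%:E)%E.
Proof.
rewrite locA Re_complex_integral /Rintegral fineK//.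
have [M M0 QM] := ReQ_le S_bnd.
have k0 : 0 <= M * L2sqn g by rewrite mulr_ge0// L2sqn_ge0.
rewrite ge0_fin_numE; last by apply: integral_ge0 => z _; rewrite lee_fin; exact: ReQ_ge0.
(* [integral_affine_le] with c = 0 is a plain bound by a constant. *)
have QM0 z : Re (Q S g z) <= 0 * cst 0 z + M * L2sqn g.
  by rewrite mul0r add0r; exact: QM.
have m0 : measurable_fun Omega (cst 0 : _ -> R) by exact: measurable_cst.
have cst0 (z : phase_space R n) : 0 <= (cst 0 z : R) by [].
have := integral_affine_le mu mOmega (mReQ g) m0 (ReQ_ge0 S_pos g) cst0 (lexx 0) k0 QM0.
rewrite mul0e add0e => /le_lt_trans; apply; exact: lte_mul_pinfty.
Qed.

Lemma normc_QB f g z : normc (Q S f z - Q S g z) = `|Re (Q S f z) - Re (Q S g z)|.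
Proof.
by rewrite (Q_real S_pos f z) (Q_real S_pos g z) -rmorphB normc_real.
Qed.

Lemma integral_QB_le f g (K t : R) : 0 < t -> 0 <= K ->
  (forall z, Re (Q S g z) <= K) ->
  (\int[mu]_(z in Omega) (normc (Q S f z - Q S g z))%:E <=
   ((1 + t^-1) * normc (inner (A (f - g)) (f - g)) + t * K * fine (mu Omega))%:E)%E.
Proof.
move=> t0 K0 gK.
have t1 : 0 <= 1 + t^-1 by rewrite addr_ge0// invr_ge0 ltW.
have tK : 0 <= t * K by rewrite mulr_ge0// ltW.
have mQB : measurable_fun Omega (fun z => `|Re (Q S f z) - Re (Q S g z)|).
  apply: measurableT_comp; first exact: normr_measurable.
  exact: (measurable_funB (mReQ f) (mReQ g)).
have QB_le z : `|Re (Q S f z) - Re (Q S g z)| <=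
    (1 + t^-1) * Re (Q S (f - g) z) + t * K.
  have := ReQ_dist S_pos g (f - g) z t0; rewrite (addrC g) subrK => /le_trans; apply.
  by rewrite lerD2l; apply: ler_wpM2l (gK z); exact: ltW.
rewrite (eq_integral (fun z => (`|Re (Q S f z) - Re (Q S g z)|)%:E)); last first.
  by move=> z _; rewrite normc_QB.
apply: le_trans.
  exact: (integral_affine_le mu mOmega mQB (mReQ (f - g)) (fun z => normr_ge0 _)
    (ReQ_ge0 S_pos _) t1 tK QB_le).
rewrite integral_ReQ -EFinM EFinD; apply: leeD.
  by rewrite lee_fin; apply: ler_wpM2l => //; apply: le_trans (ler_norm _) _; exact: le_Re_normc.
by rewrite (EFinM (t * K)) fineK// ge0_fin_numE.
Qed.

Variable p : R.
Hypothesis p1 : 1 <= p.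

Lemma in_Lp_Q f : in_Lp mu Omega p (Q S f).
Proof.
have [M M0 QM] := ReQ_le S_bnd.
have QE z : normc (Q S f z) = Re (Q S f z).
  by rewrite (Q_real S_pos) normc_real ger0_norm//; exact: ReQ_ge0.
split=> //; apply: le_lt_trans (ltry _).
apply: (Lp_norm_le mOmega p1 (mQO f) (K := M * L2sqn f)).
- by move=> z _; rewrite QE; exact: QM.
- under eq_integral do rewrite QE.
  by rewrite integral_ReQ.
Qed.

Lemma Q_weak_cvg (f_ : nat -> H) f : compact_operator A -> weak_cvg f_ f ->
  Lp_norm mu Omega p (fun z => Q S (f_ n) z - Q S f z) @[n --> \oo] --> 0%E.
Proof.
move=> cA ff; have [M M0 QM] := ReQ_le S_bnd.
have [L0 fL0] := weak_cvg_bounded ff.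
pose L := `|L0| + L2nrm f.
have L_ge0 : 0 <= L by rewrite addr_ge0// L2nrm_ge0.
have nrm_le u : L2nrm u <= L -> forall z, Re (Q S u z) <= M * L ^+ 2.
  move=> uL z; apply: le_trans (QM _ _) _; rewrite ler_wpM2l// -L2nrm2.
  by rewrite ler_sqr ?nnegrE ?L2nrm_ge0.
have fL : L2nrm f <= L by rewrite lerDr.
have fnL k : L2nrm (f_ k) <= L.
  rewrite -(subrK f (f_ k)); apply: le_trans (L2nrmD _ _) _; rewrite lerD2r.
  exact: le_trans (fL0 k) (ler_norm _).
pose K := M * L ^+ 2.
have K0 : 0 <= K by rewrite mulr_ge0// sqr_ge0.
have mQB k : complex_measurable Omega (fun z => Q S (f_ k) z - Q S f z).
  exact: complex_measurableB.
(* Both values lie in [0, K], hence so does their distance. *)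
have QBK k z : Omega z -> normc (Q S (f_ k) z - Q S f z) <= K.
  move=> _; rewrite normc_QB ler_norml.
  have := nrm_le _ (fnL k) z; have := nrm_le _ fL z; rewrite -/K.
  have := ReQ_ge0 S_pos (f_ k) z; have := ReQ_ge0 S_pos f z.
  move: (Re (Q S (f_ k) z)) (Re (Q S f z)) => a b *.
  by apply/andP; split; lra.
have Lp_le k t : 0 < t -> (Lp_norm mu Omega p (fun z => Q S (f_ k) z - Q S f z)%R <=
    ((K `^ (p - 1) * ((1 + t^-1) * normc (inner (A (f_ k - f)) (f_ k - f)) +
      t * K * fine (mu Omega))) `^ p^-1)%:E)%E.
  move=> t0; apply: (Lp_norm_le mOmega p1 (mQB k) (QBK k)).
  by exact: (integral_QB_le (f_ k) t0 K0 (nrm_le _ fL)).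
have p0 : 0 < p by exact: lt_le_trans p1.
have W0 : 0 <= fine (mu Omega) by rewrite fine_ge0.
move: Lp_le W0; move: (fine (mu Omega)) => W Lp_le W0.
set c := K `^ (p - 1) in Lp_le; have c0 : 0 <= c by exact: powR_ge0.
have small (e : R) : 0 < e -> \forall k \near \oo,
    (Lp_norm mu Omega p (fun z => Q S (f_ k) z - Q S f z)%R <= e%:E)%E.
  (* The target is e^p because a power 1/p is taken at the end. [t] is independent of [k] and makes
     the constant term at most eta / 2; [del], chosen after [t], does the same for the term with the
     operator. The [+ 1] in both denominators covers vanishing factors. *)
  move=> e0; set eta := e `^ p; have eta0 : 0 < eta by exact: powR_gt0.
  have cKW0 : 0 <= c * K * W by rewrite !mulr_ge0.
  pose t := eta / 2 / (c * K * W + 1).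
  have t0 : 0 < t by rewrite !divr_gt0// ltr_wpDl.
  have ct0 : 0 <= c * (1 + t^-1) by rewrite mulr_ge0// addr_ge0// invr_ge0 ltW.
  pose del := eta / 2 / (c * (1 + t^-1) + 1).
  have del0 : 0 < del by rewrite !divr_gt0// ltr_wpDl.
  apply: filterS (compact_weak_cvg cA ff del0) => k.
  move: (normc _) (normc_ge0 (inner (A (f_ k - f)) (f_ k - f))) (Lp_le k t t0) => r r0 + rdel.
  move=> /le_trans; apply; rewrite lee_fin.
  have -> : e = eta `^ p^-1.
    by rewrite -powRrM mulfV ?gt_eqF// powRr1// ltW.
  have b1 : c * K * W * t <= eta / 2.
    rewrite /t mulrA ler_pdivrMr ?ltr_wpDl// mulrC.
    by rewrite ler_wpM2l// ?lerDl// divr_ge0// ltW.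
  have b2 : c * (1 + t^-1) * r <= eta / 2.
    apply: (@le_trans _ _ (c * (1 + t^-1) * del)); first by rewrite ler_wpM2l// ltW.
    rewrite /del mulrA ler_pdivrMr ?ltr_wpDl// mulrC.
    by rewrite ler_wpM2l// ?lerDl// divr_ge0// ltW.
  have -> : c * ((1 + t^-1) * r + t * K * W) = c * (1 + t^-1) * r + c * K * W * t by ring.
  apply: ge0_ler_powR.
  - by rewrite invr_ge0 ltW.
  - by rewrite nnegrE; apply: addr_ge0; apply: mulr_ge0 => //; exact: ltW.
  - by rewrite nnegrE ltW.
  - by rewrite (splitr eta) lerD.
have Lp_ge0 k : (0 <= Lp_norm mu Omega p (fun z => Q S (f_ k) z - Q S f z)%R)%E.
  exact: Lnorm_ge0.
apply/fine_cvgP; split.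
  apply: filterS (small 1 ltr01) => k le1.
  by rewrite ge0_fin_numE//; apply: le_lt_trans le1 (ltry _).
apply/cvgrPdist_le => e e0; apply: filterS (small e e0) => k lee.
rewrite sub0r normrN ger0_norm ?fine_ge0//.
rewrite -lee_fin fineK// ge0_fin_numE//; exact: le_lt_trans lee (ltry _).
Qed.

End Q_continuity.

Theorem proposition3p9 (R : realType) (d : nat)
    (S : {linear L2R R d -> L2R R d})
    (Omega : set (phase_space R d)) (p : R)
    (H : {linear L2R R d -> L2R R d}) :
  bounded_operator S -> positive_operator S ->
  measurable Omega -> (0 < phase_measure R d Omega < +oo)%E ->
  1 <= p ->
  is_localization_operator Omega S H -> compact_operator H ->
  (forall f : L2R R d, in_Lp (phase_measure R d) Omega p (Q S f)) /\
  (forall (f_ : nat -> L2R R d) (f : L2R R d), weak_cvg f_ f ->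
    Lp_norm (phase_measure R d) Omega p (fun z => Q S (f_ n) z - Q S f z)
      @[n --> \oo] --> 0%E).
Proof.
move=> S_bnd S_pos mOmega /andP[_ Omega_fin] p1 locH cH; split.
- by move=> f; exact: (in_Lp_Q S_bnd S_pos mOmega Omega_fin locH p1).
- by move=> f_ f ff; exact: (Q_weak_cvg S_bnd S_pos mOmega Omega_fin locH p1).
Qed.
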